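(* Let $u_0\in\mathcal V_{[0,1]}$, let $\varepsilon>0$ with $\varepsilon^{-1}\notin\sigma(A)$, and let $\tau_n\downarrow0$ be a sequence of positive reals. Then there exists a subsequence $\tau'_n$ of $\tau_n$ with $\tau'_n<\varepsilon$ for all $n$, along which the SDIE iterates $(u_m^{[\tau'_n]},\beta_m^{[\tau'_n]})$ with initial state $u_0$ converge to the solution of the double-obstacle Allen--Cahn equation (ACE) with fidelity forcing with initial condition $u_0$ in the following sense. Let $(\hat u,\gamma)$ be the solution to the double-obstacle ACE with fidelity forcing on $[0,\infty)$ with $\hat u(0)=u_0$. Then, for each $t\ge0$, as $n\to\infty$ and with $m=\lceil t/\tau'_n\rceil$, $$u_m^{[\tau'_n]}\to\hat u(t),$$ and there is a sequence $N_k\to\infty$ of positive integers (independent of $t$) such that for almost every $t\ge0$, with $m=\lceil t/\tau'_n\rceil$, $$\frac1{N_k}\sum_{n=1}^{N_k}\beta_m^{[\tau'_n]}\to\gamma(t)\qquad\text{as }k\to\infty .$$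
   Context: Graph setting. $G=(V,E)$ is a finite, simple, undirected, weighted, connected graph without self-loops, with weights $\omega_{ij}\ge0$, $\omega_{ij}=\omega_{ji}$, $\omega_{ii}=0$, and $\omega_{ij}>0$ iff $ij\in E$; it has at least two vertices, so all degrees $d_i:=\sum_{j\in V}\omega_{ij}$ are positive. Fix $r\in[0,1]$. $\mathcal V:=\{u:V\to\mathbb R\}$; for $X\subseteq\mathbb R$, $\mathcal V_X:=\{u:V\to X\}$. For an interval $T$, $\mathcal V_{t\in T}:=\{u:T\to\mathcal V\}$ and $\mathcal V_{X,t\in T}:=\{u:T\to\mathcal V_X\}$. Inner product $\langle u,v\rangle_{\mathcal V}:=\sum_{i\in V}u_iv_id_i^r$ with norm $\|\cdot\|_{\mathcal V}$. Graph Laplacian: $(\Delta u)_i:=d_i^{-r}\sum_{j\in V}\omega_{ij}(u_i-u_j)$. $\mathbf 1$ and $\mathbf 0$ are the constant functions $1$ and $0$ on $V$, $I$ is the identity; $\sigma(F)$ is the set of eigenvalues of a linear operator $F:\mathcal V\to\mathcal V$. Fidelity. Fixed throughout: $\mu\in\mathcal V_{[0,\infty)}\setminus\{\mathbf 0\}$ and $\tilde f\in\mathcal V_{[0,1]}$. $M:=\operatorname{diag}(\mu)$, $A:=\Delta+M$ (which is invertible), $f:=M\tilde f$. Fidelity forced diffusion: $\mathcal S_tu:=e^{-tA}u+A^{-1}(I-e^{-tA})f$ for $t\ge0$, $u\in\mathcal V$. Subdifferential set. For $u\in\mathcal V$, $\mathcal B(u)=\emptyset$ if $u\notin\mathcal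 V_{[0,1]}$; for $u\in\mathcal V_{[0,1]}$, $\mathcal B(u)$ is the set of $\beta\in\mathcal V$ such that for each $i\in V$: $\beta_i\in[0,\infty)$ if $u_i=0$, $\beta_i=0$ if $0<u_i<1$, and $\beta_i\in(-\infty,0]$ if $u_i=1$. SDIE scheme with fidelity forcing. For $0<\tau<\varepsilon$, $\lambda:=\tau/\varepsilon$ and initial state $u_0\in\mathcal V_{[0,1]}$, the iterates $(u_m)_{m\ge0}$, $(\beta_m)_{m\ge1}$ are (uniquely) defined by $(1-\lambda)u_{m+1}-\mathcal S_\tau u_m+\frac\lambda2\mathbf 1=\lambda\beta_{m+1}$ with $\beta_{m+1}\in\mathcal B(u_{m+1})$. The superscript $[\tau]$ in $u_m^{[\tau]},\beta_m^{[\tau]}$ records the time step $\tau$. Double-obstacle ACE with fidelity forcing. A pair $(u,\beta)\in\mathcal V_{[0,1],t\in T}\times\mathcal V_{t\in T}$ is a solution on the interval $T$ when $u\in H^1_{loc}(T;\mathcal V)\cap C^0(T;\mathcal V)$ and for almost every $t\in T$, $\varepsilon\frac{du}{dt}(t)+\varepsilon Au(t)-\varepsilon f+\frac12\mathbf 1-u(t)=\beta(t)$ and $\beta(t)\in\mathcal B(u(t))$. Here $du/dt$ is the weak derivative and $H^1_{loc}(T;\mathcal V)$ is the set of $u:T\to\mathcal V$ with $u\in H^1((a,b);\mathcal V)$ for all $a,b\in T$. For given $u(0)\in\mathcal V_{[0,1]}$ the solution on $[0,\infty)$ is unique ($\beta$ up to a.e. equality). *)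

(* Defs.v *)
From HB Require Import structures.
From mathcomp Require Import all_boot all_order all_algebra.
From mathcomp Require Import all_classical all_reals all_analysis.

Set Implicit Arguments.
Unset Strict Implicit.
Unset Printing Implicit Defensive.

Import Order.TTheory GRing.Theory Num.Theory.
Import numFieldNormedType.Exports.

Local Open Scope classical_set_scope.
Local Open Scope ring_scope.

(* Vertices are the elements of 'I_n, a function u : V -> R is a column vector
   'cV[R]_n with u_i written [u i 0], and linear operators on such functions
   are n x n matrices acting by [F *m u]. *)

(** Weighted graphs; the edges are the pairs of positive weight. *)

Definition edge (R : realType) (n : nat) (w : 'M[R]_n) : rel 'I_n :=
  fun i j => 0 < w i j.

Definition connected_weighted_graph (R : realType) (n : nat) (w : 'M[R]_n) :
    Prop :=
  [/\ forall i j, 0 <= w i j,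
      forall i j, w i j = w j i,
      forall i, w i i = 0
    & forall i j, connect (edge w) i j].

Definition degree (R : realType) (n : nat) (w : 'M[R]_n) (i : 'I_n) : R :=
  \sum_j w i j.

Definition inner (R : realType) (n : nat) (w : 'M[R]_n) (r : R)
    (u v : 'cV[R]_n) : R :=
  \sum_i u i 0 * v i 0 * degree w i `^ r.

Definition gnorm (R : realType) (n : nat) (w : 'M[R]_n) (r : R)
    (u : 'cV[R]_n) : R :=
  Num.sqrt (inner w r u u).

Definition laplacian (R : realType) (n : nat) (w : 'M[R]_n) (r : R) : 'M[R]_n :=
  \matrix_(i, j) (degree w i `^ (- r) * ((i == j)%:R * degree w i - w i j)).

Lemma laplacianE (R : realType) (n : nat) (w : 'M[R]_n) (r : R) (u : 'cV[R]_n)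
    (i : 'I_n) :
  (laplacian w r *m u) i 0 =
  degree w i `^ (- r) * \sum_j w i j * (u i 0 - u j 0).
Proof.
rewrite mxE mulr_sumr; under eq_bigr do rewrite mxE -mulrA mulrBl.
rewrite -!mulr_sumr sumrB; congr (_ * _).
under [RHS]eq_bigr do rewrite mulrBr.
rewrite sumrB -mulr_suml; congr (_ - _).
rewrite (bigD1 i) //= eqxx mul1r big1 ?addr0// => j ji.
by rewrite eq_sym (negbTE ji) !mul0r.
Qed.

(** V_X for X = [0,1] and X = [0,+oo[. *)

Definition unit_valued (R : realType) (n : nat) : set 'cV[R]_n :=
  [set u | forall i, 0 <= u i 0 <= 1].

Definition nonneg_valued (R : realType) (n : nat) : set 'cV[R]_n :=
  [set u | forall i, 0 <= u i 0].

(** Fidelity forced diffusion. *)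

Definition fidelity_op (R : realType) (n : nat) (w : 'M[R]_n) (r : R)
    (mu : 'cV[R]_n) : 'M[R]_n :=
  laplacian w r + diag_mx mu^T.

Definition fidelity_force (R : realType) (n : nat) (mu ftilde : 'cV[R]_n) :
    'cV[R]_n :=
  diag_mx mu^T *m ftilde.

(* [eigenvalue g a] is about left eigenvectors, v *m g = a *: v; transposing
   turns it into F *m u = a *: u for a nonzero column u. *)
Definition spectrum (R : realType) (n : nat) (F : 'M[R]_n) : set R :=
  [set a | eigenvalue F^T a].

Definition expmx (R : realType) (n : nat) (F : 'M[R]_n) : 'M[R]_n :=
  limn (series (fun k : nat => (k`!%:R)^-1 *: F ^+ k)).

Definition diffusion (R : realType) (n : nat) (A : 'M[R]_n) (f : 'cV[R]_n)
    (t : R) (u : 'cV[R]_n) : 'cV[R]_n :=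
  expmx (- t *: A) *m u + invmx A *m ((1%:M - expmx (- t *: A)) *m f).

(** The subdifferential set. *)

Definition obstacle_subdiff (R : realType) (n : nat) (u : 'cV[R]_n) :
    set 'cV[R]_n :=
  [set b | unit_valued u /\
    forall i, [/\ u i 0 = 0 -> 0 <= b i 0,
                  0 < u i 0 < 1 -> b i 0 = 0
                & u i 0 = 1 -> b i 0 <= 0]].

(** The SDIE scheme; [b 0] is unconstrained, as beta_m is defined for m >= 1. *)

Definition SDIE_iterates (R : realType) (n : nat) (A : 'M[R]_n) (f : 'cV[R]_n)
    (eps tau : R) (u0 : 'cV[R]_n) (u b : nat -> 'cV[R]_n) : Prop :=
  let lambda := tau / eps in
  u 0%N = u0 /\
  forall m : nat,
    (1 - lambda) *: u m.+1 - diffusion A f tau (u m)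
      + (lambda / 2) *: const_mx 1 = lambda *: b m.+1
    /\ obstacle_subdiff (u m.+1) (b m.+1).

(** H^1(]a,b[; V) and H^1_loc(T; V). *)

Definition test_function (R : realType) (a b : R) (phi : R -> R) : Prop :=
  [/\ forall (k : nat) (x : R), derivable (derive1n k phi) x 1,
      compact (closure [set x | phi x != 0])
    & closure [set x | phi x != 0] `<=` `]a, b[].

Definition square_integrable (R : realType) (n : nat) (w : 'M[R]_n) (r : R)
    (a b : R) (u : R -> 'cV[R]_n) : Prop :=
  (forall i, measurable_fun `]a, b[ (fun t => u t i 0)) /\
  (\int[lebesgue_measure]_(t in `]a, b[) ((gnorm w r (u t)) ^+ 2)%:E < +oo)%E.

Definition weak_derivative (R : realType) (n : nat) (a b : R)
    (u v : R -> 'cV[R]_n) : Prop :=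
  forall phi : R -> R, test_function a b phi -> forall i,
    \int[lebesgue_measure]_(t in `]a, b[) (u t i 0 * derive1 phi t) =
    - \int[lebesgue_measure]_(t in `]a, b[) (v t i 0 * phi t).

Definition H1_derivative (R : realType) (n : nat) (w : 'M[R]_n) (r : R)
    (a b : R) (u v : R -> 'cV[R]_n) : Prop :=
  [/\ square_integrable w r a b u, square_integrable w r a b v
    & weak_derivative a b u v].

Definition H1 (R : realType) (n : nat) (w : 'M[R]_n) (r : R) (a b : R)
    (u : R -> 'cV[R]_n) : Prop :=
  exists v, H1_derivative w r a b u v.

Definition H1loc (R : realType) (n : nat) (w : 'M[R]_n) (r : R)
    (T : interval R) (u : R -> 'cV[R]_n) : Prop :=
  forall a b, a \in T -> b \in T -> H1 w r a b u.

(** Double-obstacle Allen--Cahn; functions T -> V are given on the whole of R,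
    their values outside T being irrelevant. [du] is the weak derivative of [u]
    on T. *)

Definition ACE_solution (R : realType) (n : nat) (w : 'M[R]_n) (r : R)
    (A : 'M[R]_n) (f : 'cV[R]_n) (eps : R) (T : interval R)
    (u b : R -> 'cV[R]_n) : Prop :=
  [/\ forall t, t \in T -> unit_valued (u t),
      H1loc w r T u,
      {within [set` T], continuous u}
    & exists2 du : R -> 'cV[R]_n,
        forall x y, x \in T -> y \in T -> H1_derivative w r x y u du
      & {ae (@lebesgue_measure R), forall t, t \in T ->
          eps *: du t + eps *: (A *m u t) - eps *: f
            + 2^-1 *: const_mx 1 - u t = b t
          /\ obstacle_subdiff (u t) (b t)}].

(** The index m = ceil (t / tau), for t >= 0. *)

Definition step_index (R : realType) (t tau : R) : nat :=
  absz (Num.ceil (t / tau)).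

(* Main.v *)
Require Import Defs.
From HB Require Import structures.
From mathcomp Require Import all_boot all_order all_algebra.
From mathcomp Require Import all_classical all_reals all_analysis.
From mathcomp Require Import measurable_realfun ring lra.

(* Write h(u) = A u - f + (1/2 - u) / eps, so that the equation reads
   u' = gamma / eps - h(u).  Up to O(tau^2) the scheme is an explicit Euler step
   for it, with beta / eps in place of gamma / eps; testing the difference of an
   arbitrary weak solution U and the iterates with itself, the multipliers
   contribute a nonpositive term, and a discrete Gronwall argument gives
   |u_m - U(t)|^2 <= C(t) tau.  Hence the whole sequence converges to every weak
   solution, without compactness.
   For existence, take a limit along an ultrafilter: it is Lipschitz, and each of
   its components satisfies u_i' = - h_i(u) classically wherever 0 < u_i < 1. A
   C^1 truncation then shows that u_i' = - h_i(u) 1_{0 < u_i < 1} weakly, and a.e.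
   differentiability gives the sign of h_i on the contact sets.
   Finally the multipliers converge pointwise at every t > 0 where U has
   derivative gamma(t) / eps - h(U(t)): if U_i(t) = 0 and h_i(U(t)) > 0, the
   iterates decrease linearly near t until they reach 0 and stay there, so they
   vanish exactly at step m, and the scheme then gives beta_m / eps = h_i + O(tau).
   So Cesaro means of the whole sequence converge a.e. *)

Set Implicit Arguments.
Unset Strict Implicit.
Unset Printing Implicit Defensive.

Import Order.TTheory GRing.Theory Num.Theory.
Import numFieldNormedType.Exports.

Local Open Scope classical_set_scope.
Local Open Scope ring_scope.

(** * The discrete scheme *)

Definition lipschitz_field (R : realType) (n : nat) (L : R)
    (h : 'cV[R]_n -> 'cV[R]_n) : Prop :=
  forall (x y : 'cV[R]_n) (d : R), (forall j, `|x j 0 - y j 0| <= d) ->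
    forall i, `|h x i 0 - h y i 0| <= L * d.

(* The common form of the SDIE iterates (with b standing for beta / eps) used
   from here on: explicit Euler steps for u' = b - h(u) up to O(tau ^ 2). *)
Definition obstacle_euler (R : realType) (n : nat) (h : 'cV[R]_n -> 'cV[R]_n)
    (K tau : R) (u b : nat -> 'cV[R]_n) : Prop :=
  (forall m, unit_valued (u m)) /\
  forall m i,
    [/\ u m.+1 i 0 < 1 -> 0 <= b m.+1 i 0,
        0 < u m.+1 i 0 -> b m.+1 i 0 <= 0,
        `|u m.+1 i 0 - u m i 0 - tau * (b m.+1 i 0 - h (u m) i 0)|
          <= K * tau ^+ 2
      & `|u m.+1 i 0 - u m i 0| <= K * tau].

Definition reflect_field (R : realType) (n : nat) (h : 'cV[R]_n -> 'cV[R]_n)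
    (x : 'cV[R]_n) : 'cV[R]_n := - h (const_mx 1 - x).

Lemma reflect_unit_valued (R : realType) (n : nat) (x : 'cV[R]_n) :
  unit_valued x -> unit_valued (const_mx 1 - x).
Proof. by move=> hx i; rewrite !mxE; have := hx i; lra. Qed.

Lemma reflect_lipschitz (R : realType) (n : nat) (L : R)
    (h : 'cV[R]_n -> 'cV[R]_n) :
  lipschitz_field L h -> lipschitz_field L (reflect_field h).
Proof.
move=> hL x y d xy i; rewrite !mxE.
rewrite -opprD normrN; apply: hL => j; rewrite !mxE -normrN.
by have := xy j; congr (`|_| <= _); ring.
Qed.

Lemma reflect_obstacle_euler (R : realType) (n : nat)
    (h : 'cV[R]_n -> 'cV[R]_n) (K tau : R) (u b : nat -> 'cV[R]_n) :
  obstacle_euler h K tau u b ->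
  obstacle_euler (reflect_field h) K tau
    (fun m => const_mx 1 - u m) (fun m => - b m).
Proof.
move=> [hu hb]; split=> [m|m i]; first exact: reflect_unit_valued.
have [b0 b1 e d] := hb m i; rewrite !mxE.
have -> : const_mx 1 - (const_mx 1 - u m) = u m by rewrite opprB addrC subrK.
split=> [u1|u1||].
- by rewrite oppr_ge0; apply: b1; lra.
- by rewrite oppr_le0; apply: b0; lra.
- by move: e; rewrite -normrN; congr (`|_| <= _); ring.
- by move: d; rewrite -normrN; congr (`|_| <= _); ring.
Qed.

Section DiscreteObstacle.
Variables (R : realType) (n : nat) (h : 'cV[R]_n -> 'cV[R]_n).
Variables (L K tau : R) (u b : nat -> 'cV[R]_n).
Hypotheses (L0 : 0 <= L) (K0 : 0 <= K) (tau0 : 0 < tau).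
Hypotheses (hL : lipschitz_field L h) (hub : obstacle_euler h K tau u b).

Let tau_ge0 : 0 <= tau.
Proof. exact: ltW. Qed.

Lemma euler_lipschitz_add (k p : nat) (i : 'I_n) :
  `|u (k + p)%N i 0 - u k i 0| <= K * (p%:R * tau).
Proof.
elim: p => [|p IH]; first by rewrite addn0 subrr normr0 mul0r mulr0.
rewrite addnS -natr1.
have [_ _ _ d] := hub.2 (k + p)%N i.
by move: d IH; rewrite !ler_norml; lra.
Qed.

Lemma euler_lipschitz (k m : nat) (i : 'I_n) :
  `|u m i 0 - u k i 0| <= K * `|m%:R * tau - k%:R * tau|.
Proof.
wlog km : k m / (k <= m)%N => [H|].
  have [/H//|/ltnW/H] := leqP k m.
  by rewrite distrC (distrC (_ * tau)).
rewrite -(subnKC km); apply: le_trans (euler_lipschitz_add k (m - k) i) _.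
rewrite ler_wpM2l//; apply: le_trans (ler_norm _).
by rewrite natrD; lra.
Qed.

Lemma euler_lower_bound (k p : nat) (i : 'I_n) :
  u k i 0 + K * (p%:R * tau) < 1 ->
  - (p%:R * tau) * h (u k) i 0
    - (L * K * (p%:R * tau) ^+ 2 + K * tau * (p%:R * tau))
    <= u (k + p)%N i 0 - u k i 0.
Proof.
elim: p => [_|p IH]; first by rewrite addn0; lra.
rewrite -natr1 addnS => lt1.
have ptau0 : 0 <= p%:R * tau by rewrite mulr_ge0.
have Ktau0 : 0 <= K * tau by rewrite mulr_ge0.
have lt1' : u k i 0 + K * (p%:R * tau) < 1 by lra.
have {}IH := IH lt1'.
have [b0 _ e _] := hub.2 (k + p)%N i.
have := euler_lipschitz_add k p.+1 i.
rewrite -natr1 addnS => d1.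
have {}b0 : 0 <= b (k + p).+1 i 0.
  by apply: b0; move: d1; rewrite ler_norml; lra.
have := hL (euler_lipschitz_add k p) i.
have : 0 <= tau * b (k + p).+1 i 0 by rewrite mulr_ge0.
move: e IH; move: (h (u (k + p)%N) i 0) (h (u k) i 0) => H H' e IH tb hh.
have {hh} : tau * (H - H') <= tau * (L * (K * (p%:R * tau))).
  by rewrite ler_wpM2l //; move: hh; rewrite ler_norml; lra.
have : 0 <= L * K * (p%:R * tau) * tau by rewrite !mulr_ge0.
have : 0 <= L * K * tau ^+ 2 by rewrite !mulr_ge0.
by move: e; rewrite ler_norml; lra.
Qed.

Lemma euler_decay (k p : nat) (i : 'I_n) (c : R) :
  2 * K * tau <= c -> (forall j, (j < p)%N -> c <= h (u (k + j)%N) i 0) ->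
  u (k + p)%N i 0 <= Num.max 0 (u k i 0 - p%:R * tau * (c / 2)).
Proof.
move=> Kc; elim: p => [_|p IH hc]; first by rewrite addn0 mul0r mul0r subr0 le_max lexx orbT.
have {}IH := IH (fun j jp => hc j (leqW jp)).
have {}hc := hc p (ltnSn p).
have [_ b1 e _] := hub.2 (k + p)%N i.
rewrite addnS -natr1 le_max.
have [//|pos] := lerP (u (k + p).+1 i 0) 0.
have : tau * b (k + p).+1 i 0 <= 0 by rewrite pmulr_rle0 ?b1.
have : tau * c <= tau * h (u (k + p)%N) i 0 by rewrite ler_wpM2l.
have := ler_wpM2l tau_ge0 Kc.
have c0 : 0 <= c by apply: le_trans Kc; rewrite !mulr_ge0.
have tc : 0 <= tau * c by rewrite mulr_ge0.
move: e IH pos; rewrite ler_norml le_max => e /orP[]; nra.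
Qed.

Lemma euler_multiplier_bound (C : R) (m : nat) (i : 'I_n) :
  tau <= 1 -> (forall m, `|h (u m) i 0| <= C) ->
  `|b m.+1 i 0| <= 2 * K + C.
Proof.
move=> tau1 hC; have [_ _ e d] := hub.2 m i.
rewrite -(ler_pM2l tau0) -[X in X * `|_|](gtr0_norm tau0) -normrM.
have := ler_wpM2l tau_ge0 (hC m); rewrite -[X in X * `|_|](gtr0_norm tau0) -normrM.
have : K * tau ^+ 2 <= K * tau by rewrite expr2 ler_wpM2l// ler_piMl// ltW.
by move: e d; rewrite !ler_norml; lra.
Qed.

End DiscreteObstacle.

Lemma step_index_bounds (R : realType) (t tau : R) : 0 <= t -> 0 < tau ->
  t <= (step_index t tau)%:R * tau < t + tau.
Proof.
move=> t0 tau0; rewrite /step_index.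
have c0 : (0 <= Num.ceil (t / tau))%R.
  by rewrite -(ler_int R); apply: le_trans (ceil_ge _); rewrite divr_ge0 // ltW.
have := ceil_itv (t / tau).
rewrite -[in X in X -> _](gez0_abs c0) => /andP[].
rewrite intrB ltrBlDr ler_pdivrMr // => lo hi; rewrite hi /=.
by move: lo; rewrite -(ltr_pM2r tau0) mulrDl divfK ?gt_eqF // mul1r.
Qed.

(** * The fidelity operator and the time step *)

Lemma cvg_mx_entries (R : realType) (m n : nat) (I : Type) (F : set_system I)
    (FF : Filter F) (s : I -> 'M[R]_(m, n)) (X : 'M[R]_(m, n)) :
  (forall i j, s k i j @[k --> F] --> X i j) -> s k @[k --> F] --> X.
Proof.
move=> sX; apply/cvg_ballP => e e0.
have : \forall k \near F, forall i j, ball (X i j) e (s k i j).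
  apply: filter_forall => i; apply: filter_forall => j.
  by have /cvg_ballP := sX i j; exact.
by apply: filterS => k h; split.
Qed.

Lemma mx_entries_bound (R : realType) (m n : nat) (F : 'M[R]_(m, n)) :
  exists2 a, 0 <= a & forall i j, `|F i j| <= a.
Proof.
exists (\sum_i \sum_j `|F i j|); first by apply: sumr_ge0 => i _; exact: sumr_ge0.
move=> i j; rewrite (bigD1 i) //= (bigD1 j) //= -addrA lerDl.
by rewrite addr_ge0 ?sumr_ge0 // => k _; exact: sumr_ge0.
Qed.

Lemma mulmx_entries_bound (R : realType) (m n p : nat) (F : 'M[R]_(m, n))
    (G : 'M[R]_(n, p)) (a c : R) : 0 <= a ->
  (forall i j, `|F i j| <= a) -> (forall i j, `|G i j| <= c) ->
  forall i j, `|(F *m G) i j| <= n%:R * (a * c).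
Proof.
move=> a0 Fa Gc i j; rewrite mxE (le_trans (ler_norm_sum _ _ _)) //.
rewrite -[n in n%:R]card_ord -sum1_card natr_sum mulr_suml; apply: ler_sum => k _.
by rewrite mul1r normrM ler_pM.
Qed.

Lemma series_exp_coeff_le (R : realType) (c : R) (N : nat) : 0 <= c ->
  \sum_(0 <= k < N) c ^+ k / k`!%:R <= expR c.
Proof.
move=> c0.
have -> : \sum_(0 <= k < N) c ^+ k / k`!%:R = series (exp_coeff c) N by [].
rewrite /expR; apply: nondecreasing_cvgn_le; last exact: is_cvg_series_exp_coeff.
apply: nondecreasing_series => k _ _; exact: exp_coeff_ge0.
Qed.

Lemma expmx_second_order (R : realType) (n : nat) (F : 'M[R]_n) :
  exists2 C, 0 <= C & forall t, 0 <= t <= 1 -> forall i j,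
    `|expmx (t *: F) i j - (1%:M + t *: F) i j| <= C * t ^+ 2.
Proof.
have [a a0 Fa] := mx_entries_bound F.
pose c := n%:R * a; have c0 : 0 <= c by rewrite mulr_ge0.
have powF k i j : `|(F ^+ k) i j| <= c ^+ k.
  elim: k i j => [|k IH] i j.
    by rewrite expr0 expr0 !mxE; case: eqP => _; rewrite ?normr1 ?normr0.
  by rewrite [F ^+ _]exprS [c ^+ _]exprS -mulrA; apply: mulmx_entries_bound.
exists (expR c); first exact: expR_ge0.
move=> t /andP[t0 t1].
pose G := t *: F.
pose v i j k := (k`!%:R)^-1 * (G ^+ k) i j.
have GE k : G ^+ k = t ^+ k *: F ^+ k.
  elim: k => [|k IH]; first by rewrite !expr0 scale1r.
  rewrite exprS IH -[_ * _]/((t *: F) *m (t ^+ k *: F ^+ k)).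
  by rewrite -scalemxAl -scalemxAr scalerA -exprS [F ^+ k.+1]exprS.
have vb i j k : `|v i j k| <= exp_coeff (t * c) k.
  rewrite /v /exp_coeff /= normrM mulrC [X in _ * X]ger0_norm ?invr_ge0 //.
  rewrite ler_wpM2r ?invr_ge0 //.
  rewrite GE mxE normrM exprMn (ger0_norm (exprn_ge0 _ t0)) ler_wpM2l ?exprn_ge0 //.
have vc i j : cvgn (series (v i j)).
  apply: normed_cvg; apply: series_le_cvg (vb i j) _ => //.
  - by move=> k; rewrite exp_coeff_ge0 // mulr_ge0.
  - exact: is_cvg_series_exp_coeff.
pose X : 'M[R]_n := \matrix_(i, j) limn (series (v i j)).
have sE i j N : (series (fun k => (k`!%:R)^-1 *: G ^+ k) N) i j = series (v i j) N.
  by rewrite /series /= summxE; apply: eq_bigr => k _; rewrite mxE.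
have sX : series (fun k => (k`!%:R)^-1 *: G ^+ k) @ \oo --> X.
  apply: cvg_mx_entries => i j; rewrite mxE.
  by under eq_fun do rewrite sE; exact: vc.
have -> : expmx (t *: F) = X by apply: cvg_lim => //; exact: norm_hausdorff.
move=> i j.
have cv : `|series (v i j) N.+2 - (1%:M + t *: F) i j| @[N --> \oo] -->
    `|X i j - (1%:M + t *: F) i j|.
  apply: cvg_norm; apply: cvgB; last exact: cvg_cst.
  have := vc i j; rewrite mxE -(cvg_shiftn 2).
  by under eq_fun do rewrite addn2.
apply: (cvgr_to_le cv); near=> N.
have -> : series (v i j) N.+2 - (1%:M + t *: F) i j = \sum_(0 <= k < N) v i j k.+2.
  rewrite /series /= 2?big_nat_recl // {1 2}/v expr0 expr1 fact0 invr1 !mul1r.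
  by rewrite !mxE; ring.
rewrite (le_trans (ler_norm_sum _ _ _)) //.
apply: (@le_trans _ _ (t ^+ 2 * \sum_(0 <= k < N) c ^+ k.+2 / k.+2`!%:R)).
  rewrite mulr_sumr; apply: ler_sum => k _; apply: le_trans (vb _ _ _) _.
  rewrite /exp_coeff /= exprMn mulrA ler_wpM2r ?invr_ge0 // ler_wpM2r ?exprn_ge0 //.
  by rewrite -addn2 exprD ler_piMl ?exprn_ge0 ?exprn_ile1.
rewrite mulrC ler_wpM2r ?sqr_ge0 //; apply: le_trans (series_exp_coeff_le N.+2 c0).
by rewrite 2?big_nat_recl // addrA lerDr addr_ge0 // divr_ge0 // exprn_ge0.
Unshelve. all: by end_near. Qed.

Section FidelityOperator.
Variables (R : realType) (n : nat) (w : 'M[R]_n) (r : R) (mu : 'cV[R]_n).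
Hypotheses (n1 : (1 < n)%N) (hw : connected_weighted_graph w).
Hypotheses (mu0 : nonneg_valued mu) (mu_neq0 : mu != 0).

Lemma degree_gt0 (i : 'I_n) : 0 < degree w i.
Proof.
have [w0 _ _ conn] := hw.
have [j ji] : exists j : 'I_n, j != i.
  by have [/= E|//] := boolP (0%N == i); [exists (Ordinal n1)|exists (Ordinal (ltnW n1))];
    rewrite -val_eqE /= -?(eqP E).
have /connectP[[|k p] /= ] := conn i j.
  by move=> _ ij; rewrite ij eqxx in ji.
move=> /andP[ik _] _; rewrite /degree (bigD1 k) //=.
by apply: ltr_pwDl => //; exact: sumr_ge0.
Qed.

Lemma fidelity_opE (u : 'cV[R]_n) (i : 'I_n) :
  (fidelity_op w r mu *m u) i 0 =
  degree w i `^ (- r) * \sum_j w i j * (u i 0 - u j 0) + mu i 0 * u i 0.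
Proof.
rewrite mulmxDl mxE laplacianE; congr (_ + _).
rewrite mul_diag_mx mxE mxE; done.
Qed.

Lemma fidelity_op_max_principle (u : 'cV[R]_n) (i : 'I_n) :
  fidelity_op w r mu *m u = 0 -> u i 0 <= 0.
Proof.
move=> Au0; have [w0 _ _ conn] := hw.
have [m _ /= um] := arg_maxP (fun j => u j 0) (erefl (xpredT i)).
apply: le_trans (um i isT) _; rewrite leNgt; apply/negP => um0.
have maxE j : u j 0 = u m 0 -> mu j 0 = 0 /\ forall k, edge w j k -> u k 0 = u m 0.
  move=> jm; have := fidelity_opE u j; rewrite Au0 mxE jm.
  have d0 : 0 < degree w j `^ (- r) by rewrite powR_gt0 // degree_gt0.
  have s0 k : 0 <= w j k * (u m 0 - u k 0) by rewrite mulr_ge0 // subr_ge0 um.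
  have S0 : 0 <= \sum_k w j k * (u m 0 - u k 0) by exact: sumr_ge0.
  have := mulr_ge0 (ltW d0) S0; have := mulr_ge0 (mu0 j) (ltW um0).
  move=> h1 h2 /esym/eqP; rewrite paddr_eq0 // => /andP[].
  rewrite mulf_eq0 gt_eqF //= => /eqP sum0.
  rewrite mulf_eq0 (gt_eqF um0) orbF => /eqP ->; split=> // k jk.
  have /eqP : w j k * (u m 0 - u k 0) = 0.
    exact: (psumr_eq0P (fun k _ => s0 k) sum0).
  by rewrite mulf_eq0 subr_eq0 gt_eqF //= => /eqP ->.
have path_max p j : u j 0 = u m 0 -> path (edge w) j p ->
    u (last j p) 0 = u m 0.
  elim: p j => //= k p IH j jm /andP[jk pth].
  by apply: IH pth; apply: (maxE _ jm).2.
have all_max j : u j 0 = u m 0.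
  by have /connectP[p pth ->] := conn m j; exact: path_max.
move/eqP: mu_neq0; apply; apply/matrixP => j k; rewrite ord1 mxE.
by have [] := maxE j (all_max j).
Qed.

Lemma fidelity_op_unit : fidelity_op w r mu \in unitmx.
Proof.
rewrite -unitmx_tr -row_free_unit; apply: inj_row_free => v vA.
have Av : fidelity_op w r mu *m v^T = 0 by rewrite -[LHS]trmxK trmx_mul trmxK vA trmx0.
have AvN : fidelity_op w r mu *m (- v^T) = 0 by rewrite mulmxN Av oppr0.
apply/matrixP => i j; rewrite ord1 mxE; apply: le_anti.
have := fidelity_op_max_principle j Av.
have := fidelity_op_max_principle j AvN; rewrite !mxE oppr_le0 => -> ->.
by [].
Qed.

End FidelityOperator.

Lemma mulmx_lipschitz (R : realType) (n : nat) (A : 'M[R]_n) :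
  exists2 L, 0 <= L & lipschitz_field L (mulmx A : 'cV[R]_n -> 'cV[R]_n).
Proof.
have [a a0 Aa] := mx_entries_bound A.
exists (n%:R * a); first by rewrite mulr_ge0.
move=> x y d xy i.
have := @mulmx_entries_bound _ _ _ _ A (x - y) a d a0 Aa _ i 0.
rewrite mulmxBr !mxE -mulrA; apply=> k l.
by rewrite (ord1 l) !mxE.
Qed.

Lemma diffusion_second_order (R : realType) (n : nat) (A : 'M[R]_n)
    (f : 'cV[R]_n) : A \in unitmx ->
  exists2 C, 0 <= C & forall t, 0 <= t <= 1 -> forall u, unit_valued u ->
    forall i, `|diffusion A f t u i 0 - (u - t *: (A *m u - f)) i 0| <= C * t ^+ 2.
Proof.
move=> Au.
have [C C0 CE] := expmx_second_order (- A).
have [a a0 Aa] := mx_entries_bound (invmx A).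
have [c c0 fc] := mx_entries_bound f.
exists (n%:R * (C * 1) + n%:R * (a * (n%:R * (C * c)))).
  by apply: addr_ge0; repeat apply: mulr_ge0.
move=> t t01 u u01 i.
have [E Edef] : exists E, E = expmx (- t *: A) - (1%:M - t *: A) by eexists.
have EC k l : `|E k l| <= C * t ^+ 2.
  have := CE t t01 k l; rewrite scalerN -scaleNr.
  suff -> : E k l = expmx (- t *: A) k l - (1%:M + - t *: A) k l by [].
  by rewrite Edef scaleNr mxE [X in _ + X]mxE.
have Ct0 : 0 <= C * t ^+ 2 by rewrite mulr_ge0 ?sqr_ge0.
have -> : diffusion A f t u i 0 - (u - t *: (A *m u - f)) i 0 =
    (E *m u) i 0 - (invmx A *m (E *m f)) i 0.
  have -> : diffusion A f t u = u - t *: (A *m u - f) + (E *m u - invmx A *m (E *m f)).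
    rewrite /diffusion.
    have -> : expmx (- t *: A) = E + (1%:M - t *: A) by rewrite Edef subrK.
    have -> : 1%:M - (E + (1%:M - t *: A)) = t *: A - E.
      by rewrite [E + _]addrC opprD opprB addrA [1%:M + _]addrC subrK.
    rewrite !mulmxDl !mulNmx !mulmxDr !mulmxN mul1mx -!scalemxAl -scalemxAr mulKmx //.
    rewrite scalerBr; move: (E *m u) (invmx A *m (E *m f)) (t *: (A *m u)) (t *: f) => x1 x2 x3 x4.
    by apply/matrixP => k l; rewrite !mxE; ring.
  by move: (u - _) (E *m u) (invmx A *m _) => X Y Z; rewrite !mxE; ring.
have h1 : `|(E *m u) i 0| <= n%:R * (C * t ^+ 2 * 1).
  apply: (mulmx_entries_bound Ct0 EC) => k l; rewrite (ord1 l).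
  by have := u01 k; rewrite ler_norml; lra.
have h2 : `|(invmx A *m (E *m f)) i 0| <= n%:R * (a * (n%:R * (C * t ^+ 2 * c))).
  by apply: (mulmx_entries_bound a0 Aa) => k l; apply: (mulmx_entries_bound Ct0 EC).
by apply: (le_trans (ler_normB _ _)); lra.
Qed.

Definition ACE_field (R : realType) (n : nat) (A : 'M[R]_n) (f : 'cV[R]_n)
    (eps : R) (u : 'cV[R]_n) : 'cV[R]_n :=
  A *m u - f + eps^-1 *: (2^-1 *: const_mx 1 - u).

Lemma ACE_field_lipschitz (R : realType) (n : nat) (A : 'M[R]_n)
    (f : 'cV[R]_n) (eps : R) : 0 < eps ->
  exists2 L, 0 <= L & lipschitz_field L (ACE_field A f eps).
Proof.
move=> eps0; have [L L0 AL] := mulmx_lipschitz A.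
exists (L + eps^-1); first by rewrite addr_ge0 // invr_ge0 ltW.
move=> x y d xy i; rewrite /ACE_field.
have h1 := AL _ _ _ xy i.
have h2 : `|eps^-1 * (x i 0 - y i 0)| <= eps^-1 * d.
  rewrite normrM ger0_norm ?invr_ge0 ?(ltW eps0) // ler_wpM2l //.
  by rewrite invr_ge0 ltW.
move: (A *m x) (A *m y) h1 => Ax Ay; rewrite !mxE.
by move: h2; rewrite !ler_norml; lra.
Qed.

Lemma lipschitz_field_bounded (R : realType) (n : nat)
    (h : 'cV[R]_n -> 'cV[R]_n) (L : R) : 0 <= L -> lipschitz_field L h ->
  exists2 H, 0 <= H & forall u, unit_valued u -> forall i, `|h u i 0| <= H.
Proof.
move=> L0 hL; have [c c0 hc] := mx_entries_bound (h 0).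
exists (L + c); first exact: addr_ge0.
move=> u u01 i.
have : `|h u i 0 - h 0 i 0| <= L * 1.
  apply: hL => j; rewrite mxE subr0; have /andP[u0 u1] := u01 j.
  by rewrite ger0_norm.
by have := hc i 0; rewrite !ler_norml; lra.
Qed.

Lemma SDIE_obstacle_euler (R : realType) (n : nat) (A : 'M[R]_n)
    (f : 'cV[R]_n) (eps : R) : A \in unitmx -> 0 < eps ->
  exists2 K, 0 <= K & forall tau, 0 < tau -> tau <= 1 -> tau <= eps / 2 ->
    forall u0 u b, unit_valued u0 -> SDIE_iterates A f eps tau u0 u b ->
      obstacle_euler (ACE_field A f eps) K tau u (fun m => eps^-1 *: b m).
Proof.
move=> Au eps0; have [L L0 hL] := ACE_field_lipschitz A f eps0.
have [H H0 hH] := lipschitz_field_bounded L0 hL.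
have [C C0 hC] := diffusion_second_order f Au.
have ieps : 0 < eps^-1 by rewrite invr_gt0.
exists (4 * (H + C) * (1 + eps^-1) + C).
  by rewrite addr_ge0 // mulr_ge0 ?addr_ge0 ?mulr_ge0 ?addr_ge0 // ltW.
move=> tau tau0 tau1 taue u0 u b hu0 [uz step].
have u01 m : unit_valued (u m).
  by case: m => [|m]; [rewrite uz|have [_ []] := step m].
split=> // m i; have [eqn [_ /(_ i)[b_lo b_mid b_hi]]] := step m.
set B := (eps^-1 *: b m.+1) i 0.
have BE : B = eps^-1 * b m.+1 i 0 by rewrite /B mxE.
have /andP[u'0 u'1] := u01 m.+1 i; have /andP[um0 um1] := u01 m i.
have B_ge : u m.+1 i 0 < 1 -> 0 <= B.
  rewrite BE pmulr_rge0 // => lt1; move: u'0; rewrite le_eqVlt => /predU1P[/esym/b_lo//|gt0].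
  by rewrite b_mid // gt0.
have B_le : 0 < u m.+1 i 0 -> B <= 0.
  rewrite BE pmulr_rle0 // => gt0; move: u'1; rewrite le_eqVlt => /predU1P[/b_hi//|lt1].
  by rewrite b_mid // gt0.
have t01 : 0 <= tau <= 1 by rewrite (ltW tau0).
have := hC tau t01 (u m) (u01 m) i; have := hH (u m) (u01 m) i.
have /matrixP/(_ i 0) := eqn; rewrite /ACE_field.
move: (diffusion A f tau (u m)) (A *m u m) => S Au_m.
rewrite !mxE -/B => eqS hb eS.
pose e := S i 0 - (u m i 0 - tau * (Au_m i 0 - f i 0)).
have he : `|e| <= C * tau ^+ 2 by move: eS; rewrite /e; congr (`|_| <= _); ring.
set h := Au_m i 0 - f i 0 + _ in hb *.
pose y := u m.+1 i 0 - u m i 0.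
have lam : 0 < tau / eps <= 2^-1.
  by rewrite divr_gt0 //= ler_pdivrMr // mulrC.
have main : (1 - tau / eps) * y = tau * (B - h) + e.
  have -> : B = eps^-1 * b m.+1 i 0 by [].
  apply/eqP; rewrite -subr_eq0; move/eqP: eqS; rewrite -subr_eq0 => /eqP eqS.
  by apply/eqP; rewrite -eqS /y /e /h; field; rewrite gt_eqF.
have tC : C * tau ^+ 2 <= C * tau by rewrite ler_wpM2l // expr2 ler_piMl // ltW.
have th : `|tau * h| <= tau * H by rewrite normrM gtr0_norm // ler_pM2l.
have tB : `|tau * B| <= tau * H + C * tau.
  have yb : `|(1 - tau / eps) * y| <= `|y| by rewrite normrM ler_piMl // ler_norml; lra.
  have [uz0|nz] := eqVneq (u m.+1 i 0) 0.
    have B0 : 0 <= tau * B by rewrite mulr_ge0 ?(ltW tau0) // B_ge // uz0.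
    have y0 : (1 - tau / eps) * y <= 0 by rewrite mulr_ge0_le0 //; rewrite /y; lra.
    by rewrite ger0_norm //; move: th he; rewrite !ler_norml; lra.
  have pos : 0 < u m.+1 i 0 by rewrite lt_neqAle eq_sym nz.
  have [u1|no] := eqVneq (u m.+1 i 0) 1.
    have B0 : tau * B <= 0 by rewrite mulr_ge0_le0 ?(ltW tau0) ?B_le.
    have y0 : 0 <= (1 - tau / eps) * y by rewrite mulr_ge0 //; rewrite /y; lra.
    by rewrite ler0_norm //; move: th he; rewrite !ler_norml; lra.
  have lt1 : u m.+1 i 0 < 1 by rewrite lt_neqAle no.
  have -> : B = 0 by apply: le_anti; rewrite B_le ?B_ge.
  by rewrite mulr0 normr0 addr_ge0 // mulr_ge0 // ltW.
have yb : `|y| <= 4 * (H + C) * tau.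
  have : `|(1 - tau / eps) * y| <= 2 * (H + C) * tau.
    rewrite main mulrBr; move: th he tB; rewrite !ler_norml; lra.
  rewrite normrM ger0_norm; last by lra.
  have := normr_ge0 y; move: (`|y|) => ay; nra.
split=> //.
- have -> : u m.+1 i 0 - u m i 0 - tau * (B - h) = tau / eps * y + e.
    by rewrite -/y; move: main; lra.
  have : `|tau / eps * y| <= 4 * (H + C) * eps^-1 * tau ^+ 2.
    rewrite normrM gtr0_norm ?divr_gt0 //.
    apply: (le_trans (ler_wpM2l (ltW (andP lam).1) yb)).
    by rewrite le_eqVlt; apply/orP; left; apply/eqP; ring.
  have : 0 <= 4 * (H + C) * tau ^+ 2 by rewrite mulr_ge0 ?sqr_ge0 // mulr_ge0 // addr_ge0.
  by move: he; rewrite !ler_norml; lra.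
- apply: (le_trans yb).
  have : 0 <= 4 * (H + C) * eps^-1 * tau by rewrite !mulr_ge0 ?addr_ge0 // ltW.
  have : 0 <= C * tau by rewrite mulr_ge0 // ltW.
  by lra.
Qed.

(** * Smooth functions *)

Lemma is_derive_quadratic_remainder (R : realType) (f : R -> R) (x d C e : R) :
  0 < e ->
  (forall y, `|y - x| < e -> `|f y - f x - (y - x) * d| <= C * (y - x) ^+ 2) ->
  is_derive x 1 f d.
Proof.
move=> e0 fC.
have dfx : h^-1 *: ((f \o shift x) (h *: 1) - f x) @[h --> 0^'] --> d.
  apply/cvgrPdist_le => eps eps0; pose c := Num.max C 1.
  have c0 : 0 < c by rewrite lt_max ltr01 orbT.
  near=> h.
  have h0 : h != 0 by near: h; exact: nbhs_dnbhs_neq.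
  have he : `|h| < e by near: h; apply: dnbhs0_lt.
  have hc : `|h| <= eps / c by near: h; apply: dnbhs0_le; rewrite divr_gt0.
  have := fC (h + x); rewrite addrK => /(_ he) fh.
  rewrite /= [h *: 1]mulr1 -[X in _ <= X]mulr1.
  have -> : d - h^-1 *: (f (h + x) - f x) =
      - (h^-1 * (f (h + x) - f x - h * d)) by rewrite /GRing.scale /=; field.
  rewrite normrN normrM normfV ler_pdivrMl ?normr_gt0 //.
  apply: (le_trans fh); rewrite -real_normK ?num_real // expr2 mulr1 mulrA mulrC.
  apply: ler_wpM2l => //; apply: (@le_trans _ _ (c * `|h|)).
    by rewrite ler_wpM2r // le_max lexx.
  by rewrite mulrC -ler_pdivlMr.
have cfx : cvg (h^-1 *: ((f \o shift x) (h *: 1) - f x) @[h --> 0^']).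
  by apply/cvg_ex; exists d.
by apply: DeriveDef => //; rewrite /derive; apply: cvg_lim.
Unshelve. all: by end_near. Qed.

Lemma derive1_nondecreasing_ge0 (R : realType) (f : R -> R) (x : R) :
  {homo f : x y / x <= y} -> derivable f x 1 -> 0 <= derive1 f x.
Proof.
move=> ndf df; rewrite derive1E /derive; apply: limr_ge => //.
near=> h; have h0 : h != 0 by near: h; exact: nbhs_dnbhs_neq.
rewrite /= [h *: 1]mulr1 /GRing.scale /= mulrC.
have [h1|h1] := ltP 0 h.
  by rewrite divr_ge0 ?(ltW h1) // subr_ge0 ndf // lerDr ltW.
by rewrite mulr_le0 ?invr_le0 // subr_le0 ndf // gerDr.
Unshelve. all: by end_near. Qed.

Section SmoothFunctions.
Variable R : realType.

Fixpoint Ck (k : nat) (f : R -> R) : Prop :=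
  if k is k'.+1 then (forall x, derivable f x 1) /\ Ck k' (derive1 f) else True.

Definition smooth (f : R -> R) : Prop := forall k, Ck k f.

Lemma smooth_derive1n (f : R -> R) (k : nat) (x : R) :
  smooth f -> derivable (derive1n k f) x 1.
Proof.
move=> /(_ k.+1); elim: k f => [|k IH] f; first by case.
by move=> [df /IH]; rewrite derive1Sn.
Qed.

Lemma smooth_derivable (f : R -> R) (x : R) : smooth f -> derivable f x 1.
Proof. by move=> /(_ 1%N)[]. Qed.

Lemma smooth_derive1 (f : R -> R) : smooth f -> smooth (derive1 f).
Proof. by move=> sf k; have [] := sf k.+1. Qed.

Lemma CkS (k : nat) (f : R -> R) : Ck k.+1 f -> Ck k f.
Proof. by elim: k f => [//|k IH] f [df /IH]. Qed.

Lemma Ck_cst (k : nat) (c : R) : Ck k (fun=> c).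
Proof.
elim: k c => [//|k IH] c; split=> [x|]; first exact: derivable_cst.
by rewrite (_ : derive1 _ = (fun=> 0)); [exact: IH|apply/funext => x; exact: derive1_cst].
Qed.

Lemma Ck_add (k : nat) (f g : R -> R) :
  Ck k f -> Ck k g -> Ck k (fun x => f x + g x).
Proof.
elim: k f g => [//|k IH] f g [df f'] [dg g']; split=> [x|].
  exact: derivableD.
rewrite (_ : derive1 _ = (fun x => derive1 f x + derive1 g x)); first exact: IH.
by apply/funext => x; rewrite !derive1E deriveD.
Qed.

Lemma Ck_mul (k : nat) (f g : R -> R) :
  Ck k f -> Ck k g -> Ck k (fun x => f x * g x).
Proof.
elim: k f g => [//|k IH] f g cf cg.
have [df f'] := cf; have [dg g'] := cg; split=> [x|].
  exact: derivableM.
rewrite (_ : derive1 _ = (fun x => f x * derive1 g x + g x * derive1 f x)).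
  by apply: Ck_add; apply: IH => //; exact: CkS.
by apply/funext => x; rewrite !derive1E (deriveM (df x) (dg x)).
Qed.

Lemma Ck_comp (k : nat) (f g : R -> R) :
  Ck k f -> Ck k g -> Ck k (fun x => f (g x)).
Proof.
elim: k f g => [//|k IH] f g cf cg.
have [df f'] := cf; have [dg g'] := cg; split=> [x|].
  by case: (is_derive1_comp (derivableP (df (g x))) (derivableP (dg x))).
rewrite (_ : derive1 _ = (fun x => derive1 f (g x) * derive1 g x)).
  by apply: Ck_mul => //; apply: IH => //; exact: CkS.
by apply/funext => x; rewrite -(derive1_comp (dg x) (df (g x))).
Qed.

Lemma Ck_id (k : nat) : Ck k id.
Proof.
case: k => // k; split=> [x|]; first exact: derivable_id.
rewrite (_ : derive1 (@id R) = (fun=> 1)); first exact: Ck_cst.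
by apply/funext => x; rewrite derive1E derive_id.
Qed.

(* Closed under differentiation, and flat at 0 : for p = 1 it is the standard
   C^oo function that vanishes exactly on the left half-line. *)
Definition flat (p : {poly R}) (x : R) : R :=
  if 0 < x then p.[x^-1] * expR (- x^-1) else 0.

Lemma horner_le_expR (p : {poly R}) :
  exists C, forall y, 0 <= y -> `|p.[y]| <= C * expR y.
Proof.
exists (\sum_(i < size p) `|p`_i| * i`!%:R) => y y0.
rewrite horner_coef (le_trans (ler_norm_sum _ _ _))// mulr_suml.
apply: ler_sum => i _; rewrite normrM -mulrA ler_wpM2l // ger0_norm ?exprn_ge0//.
rewrite mulrC -ler_pdivrMr ?ltr0n ?fact_gt0 //.
case: (val i) => [|j]; last by rewrite (le_trans _ (expR_ge1Dxn j y0)) // lerDr.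
by rewrite expr0 fact0 divr1 -expR0 ler_expR.
Qed.

Lemma flat_quadratic (p : {poly R}) :
  exists C, forall x, `|flat p x| <= C * x ^+ 2.
Proof.
have [C hC] := horner_le_expR (p * 'X^2).
have C0 : 0 <= C by have := hC 0 (lexx 0); rewrite expR0 mulr1; exact: le_trans.
exists C => x; rewrite /flat; case: ifPn => [x0|_]; last by rewrite normr0 mulr_ge0 ?sqr_ge0.
have := hC x^-1; rewrite invr_ge0 (ltW x0) => /(_ isT).
rewrite hornerM hornerXn normrM (ger0_norm (sqr_ge0 _)) => hx.
rewrite normrM (gtr0_norm (expR_gt0 _)) expRN ler_pdivrMr ?expR_gt0 //.
move: hx; rewrite -ler_pdivlMr ?exprn_gt0 ?invr_gt0 //.
by rewrite exprVn invrK mulrAC.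
Qed.

Lemma is_derive_flat (p : {poly R}) (x : R) :
  is_derive x 1 (flat p) (flat ('X^2 * (p - p^`())) x).
Proof.
have [x0|x0|->] := ltrgtP x 0.
- rewrite {2}/flat lt_gtF //=.
  apply: (near_eq_is_derive (f := cst 0)).
  by near=> y; rewrite /flat lt_gtF //; near: y; exact: lt_nbhsl.
- have near_flat : \near x, p.[x^-1] * expR (- x^-1) = flat p x.
    by near=> y; rewrite /flat ifT //; near: y; exact: lt_nbhsr.
  have dV : is_derive x 1 (fun y : R => y^-1) (- x ^- 2 *: 1).
    by apply: (@is_deriveV _ id); rewrite ?gt_eqF.
  have dN := is_deriveN dV.
  have d1 := is_derive1_comp (is_derive_poly p x^-1) dV.
  have d2 := @is_derive1_comp _ expR (- (fun y : R => y^-1)) x _ _ (is_derive_expR _) dN.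
  apply: (near_eq_is_derive near_flat).
  apply: is_derive_eq (is_deriveM d1 d2) _.
  rewrite /flat x0 !hornerM !hornerD !hornerN hornerX /GRing.scale /= mulr1.
  by field; rewrite gt_eqF.
- have [C hC] := flat_quadratic p.
  have f0 q : flat q 0 = 0 by rewrite /flat ltxx.
  rewrite f0; apply: (@is_derive_quadratic_remainder _ _ _ _ C 1) => // y _.
  by rewrite f0 mulr0 !subr0.
Unshelve. all: by end_near. Qed.

Lemma Ck_flat (k : nat) (p : {poly R}) : Ck k (flat p).
Proof.
elim: k p => [//|k IH] p; split=> [x|]; first by case: (is_derive_flat p x).
rewrite (_ : derive1 _ = flat ('X^2 * (p - p^`()))); first exact: IH.
by apply/funext => x; have [_ <-] := is_derive_flat p x; rewrite derive1E.
Qed.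

Lemma smooth_step : exists psi : R -> R,
  [/\ smooth psi, {homo psi : x y / x <= y}, forall x, 0 <= psi x <= 1,
      forall x, x <= 0 -> psi x = 0 & forall x, 1 <= x -> psi x = 1].
Proof.
pose E := flat 1.
have EE x : 0 < x -> E x = expR (- x^-1) by move=> x0; rewrite /E /flat x0 hornerC mul1r.
have E0 x : x <= 0 -> E x = 0 by move=> x0; rewrite /E /flat ltNge x0.
have Ege0 x : 0 <= E x.
  by have [/E0->//|/EE->] := lerP x 0; rewrite expR_ge0.
have Emono x y : x <= y -> E x <= E y.
  have [/E0->//|x0 xy] := lerP x 0.
  rewrite !EE ?(lt_le_trans x0) // ler_expR lerN2 lef_pV2 //.
  by rewrite posrE (lt_le_trans x0).
have Ehalf : 0 < E 2^-1 by rewrite EE ?expR_gt0.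
exists (fun x => 1 + - (E 2^-1)^-1 * E (2^-1 + (-1) * E (2 * x))); split.
- move=> k; apply: Ck_add; first exact: Ck_cst.
  apply: Ck_mul; first exact: Ck_cst.
  apply: (Ck_comp (Ck_flat k 1)); apply: Ck_add; first exact: Ck_cst.
  apply: Ck_mul; first exact: Ck_cst.
  apply: (Ck_comp (Ck_flat k 1)); apply: Ck_mul; [exact: Ck_cst|exact: Ck_id].
- move=> x y xy; rewrite lerD2l !mulNr lerN2; apply: ler_wpM2l.
    by rewrite invr_ge0 ltW.
  by apply: (Emono); rewrite ?mul1r lerD2l lerN2 (Emono _ _) // ler_wpM2l.
- move=> x; rewrite mulN1r mulNr mulrC.
  have : 0 <= E (2^-1 - E (2 * x)) / E 2^-1 by rewrite divr_ge0 // ltW.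
  have : E (2^-1 - E (2 * x)) / E 2^-1 <= 1.
    by rewrite ler_pdivrMr // mul1r Emono // lerBlDr lerDl.
  by lra.
- move=> x x0; rewrite (E0 (2 * x)) ?pmulr_rle0 // mulr0 addr0.
  by rewrite mulNr mulVf ?subrr // gt_eqF.
- move=> x x1; suff h : 2^-1 <= E (2 * x) by rewrite (E0 (_ + _)) ?mulr0 ?addr0 //; lra.
  apply: (@le_trans _ _ (E 2)); last by apply: (Emono); lra.
  by rewrite EE //; apply: le_trans (expR_ge1Dx _); lra.
Qed.

End SmoothFunctions.

(** * Weak derivatives and increments *)

Lemma Rintegral_dominated_cvg d (T : measurableType d) (R : realType)
    (mu : {measure set T -> \bar R}) (D : set T) (f_ : nat -> T -> R)
    (f g : T -> R) :
  measurable D -> (forall k, measurable_fun D (f_ k)) ->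
  (forall x, D x -> f_ k x @[k --> \oo] --> f x) ->
  mu.-integrable D (EFin \o g) ->
  (forall k x, D x -> `|f_ k x| <= g x) ->
  \int[mu]_(x in D) f_ k x @[k --> \oo] --> \int[mu]_(x in D) f x.
Proof.
move=> mD mf ff ig fg.
have bd k x : D x -> (`|(EFin \o f_ k) x| <= (EFin \o g) x)%E.
  by move=> Dx; rewrite /= lee_fin fg.
have mff k := (measurable_EFinP D (f_ k)).2 (mf k).
have cf x : D x -> (EFin \o f_ k) x @[k --> \oo] --> (EFin \o f) x.
  by move=> Dx; apply: cvg_EFin; [exact: nearW|exact: ff].
have fing x : D x -> (EFin \o g) x \is a fin_num by [].
have := dominated_cvg mD mff cf fing ig bd.
have mfl := (measurable_EFinP D f).2 (measurable_fun_cvg mf ff).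
have [fi _ _] := dominated_convergence mD mff mfl (aeW _ cf) ig
  (aeW mu (fun x n => @bd n x)).
by rewrite -(fineK (integrable_fin_num mD fi)) => /fine_cvgP[_].
Qed.

Section IntegrableEFin.
Context d (T : measurableType d) (R : realType).
Variables (mu : {measure set T -> \bar R}) (D : set T).
Hypothesis mD : measurable D.

Lemma integrable_EFinD (f g : T -> R) :
  mu.-integrable D (EFin \o f) -> mu.-integrable D (EFin \o g) ->
  mu.-integrable D (EFin \o (fun x => f x + g x)).
Proof. by move=> fi gi; apply: eq_integrable (integrableD mD fi gi). Qed.

Lemma integrable_EFinB (f g : T -> R) :
  mu.-integrable D (EFin \o f) -> mu.-integrable D (EFin \o g) ->
  mu.-integrable D (EFin \o (fun x => f x - g x)).
Proof. by move=> fi gi; apply: eq_integrable (integrableB mD fi gi). Qed.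

Lemma integrable_EFinZl (c : R) (f : T -> R) :
  mu.-integrable D (EFin \o f) ->
  mu.-integrable D (EFin \o (fun x => c * f x)).
Proof. by move=> fi; apply: eq_integrable (integrableZl mD c fi). Qed.

End IntegrableEFin.

Section WeakDerivative.
Variable R : realType.
Local Notation mu := (@lebesgue_measure R).

Lemma continuous_within_integrable (a b : R) (f : R -> R) :
  {within `[a, b], continuous f} -> mu.-integrable `]a, b[ (EFin \o f).
Proof.
move=> cf; apply: (@integrableS _ _ _ mu `[a, b]%classic) => //.
  exact: subset_itv_oo_cc.
by apply: continuous_compact_integrable cf; exact: segment_compact.
Qed.

Lemma Rintegral_FTC2 (a b : R) (F f : R -> R) :
  a < b -> {within `[a, b], continuous F} -> {within `[a, b], continuous f} ->
  (forall x, x \in `]a, b[ -> is_derive x 1 F (f x)) ->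
  \int[mu]_(x in `]a, b[) f x = F b - F a.
Proof.
move=> ab cF cf Ff; have [cFi cFa cFb] := (continuous_within_itvP F ab).1 cF.
rewrite Rintegral_itv_obnd_cbnd; last exact: continuous_within_integrable.
rewrite Rintegral_itv_bndo_bndc; last first.
  apply: (@integrableS _ _ _ mu `[a, b]%classic) => //.
    by apply: subset_itv; rewrite bnd_simp.
  by apply: continuous_compact_integrable cf; exact: segment_compact.
rewrite /Rintegral (@continuous_FTC2 _ _ F _ _ ab) //.
- by split=> // x /Ff[].
- by move=> x /Ff[_ <-]; rewrite derive1E.
Qed.

Lemma smooth_continuous (f : R -> R) : smooth f -> continuous f.
Proof. by move=> sf x; apply/differentiable_continuous/derivable1_diffP/smooth_derivable. Qed.

Lemma within_continuousM (A : set R) (f g : R -> R) :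
  {within A, continuous f} -> {within A, continuous g} ->
  {within A, continuous (fun x => f x * g x)}.
Proof. by move=> cf cg x; apply: cvgM; [exact: cf|exact: cg]. Qed.

Variable psi : R -> R.
Hypotheses (psi_smooth : smooth psi) (psi_homo : {homo psi : x y / x <= y}).
Hypotheses (psi_itv : forall x, 0 <= psi x <= 1).
Hypotheses (psi0 : forall x, x <= 0 -> psi x = 0).
Hypotheses (psi1 : forall x, 1 <= x -> psi x = 1).

(* Increases from 0 to 1 between s + 1 / (k + 1) and s + 2 / (k + 1). *)
Definition mollified_step (s : R) (k : nat) (x : R) : R :=
  psi (k.+1%:R * (x - s) - 1).

Lemma mollified_step_smooth (s : R) (k : nat) : smooth (mollified_step s k).
Proof.
move=> j; apply: (Ck_comp (psi_smooth j)).
apply: Ck_add; last exact: Ck_cst.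
apply: Ck_mul; first exact: Ck_cst.
by apply: Ck_add; [exact: Ck_id|exact: Ck_cst].
Qed.

Lemma mollified_step_homo (s : R) (k : nat) :
  {homo mollified_step s k : x y / x <= y}.
Proof.
move=> x y xy; apply: psi_homo.
by rewrite lerD2r ler_wpM2l ?ler0n // lerD2r.
Qed.

Lemma mollified_step0 (s : R) (k : nat) (x : R) :
  x <= s + k.+1%:R^-1 -> mollified_step s k x = 0.
Proof.
move=> xs; apply: psi0; rewrite subr_le0 -ler_pdivlMl ?ltr0n // mulr1.
by rewrite lerBlDl.
Qed.

Lemma mollified_step1 (s : R) (k : nat) (x : R) :
  s + 2 / k.+1%:R <= x -> mollified_step s k x = 1.
Proof.
move=> xs; apply: psi1; rewrite lerBrDr -ler_pdivrMl ?ltr0n // lerBrDl mulrC.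
by apply: le_trans xs; rewrite lerD2l ler_wpM2r // ?invr_ge0 // -natrD.
Qed.

Lemma derive1_mollified_step_support (s : R) (k : nat) (x : R) :
  derive1 (mollified_step s k) x != 0 -> s < x <= s + 2 / k.+1%:R.
Proof.
apply: contraNT; rewrite negb_and -leNgt -ltNge => /orP[xs|xs].
  have : is_derive x 1 (mollified_step s k) 0.
    apply: (@near_eq_is_derive _ _ _ (cst (0 : R))).
    near=> y; rewrite mollified_step0 // ltW //; near: y.
    by apply: lt_nbhsl; rewrite (le_lt_trans xs) // ltrDl invr_gt0.
  by case=> _; rewrite derive1E => ->.
have : is_derive x 1 (mollified_step s k) 0.
  apply: (@near_eq_is_derive _ _ _ (cst (1 : R))).
  by near=> y; rewrite mollified_step1 // ltW //; near: y; exact: lt_nbhsr.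
by case=> _; rewrite derive1E => ->.
Unshelve. all: by end_near. Qed.

Lemma integral_derive1_mollified_step (a b s : R) (k : nat) (f : R -> R) :
  a <= s -> s + 2 / k.+1%:R < b -> {within `[a, b], continuous f} ->
  mu.-integrable `]a, b[ (EFin \o (fun x => f x * derive1 (mollified_step s k) x)) /\
  \int[mu]_(x in `]a, b[) derive1 (mollified_step s k) x = 1.
Proof.
move=> as_ sb cf; have ms := mollified_step_smooth s k.
have cd : continuous (derive1 (mollified_step s k)).
  exact/smooth_continuous/smooth_derive1.
have s2 : s < s + 2 / k.+1%:R by rewrite ltrDl divr_gt0.
have ab : a < b by apply: le_lt_trans as_ (lt_trans s2 sb).
split.
  apply: continuous_within_integrable; apply: within_continuousM => //.
  exact: continuous_subspaceT.
have dF x : x \in `]a, b[ ->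
    is_derive x 1 (mollified_step s k) (derive1 (mollified_step s k) x).
  by move=> _; rewrite derive1E; apply/derivableP/smooth_derivable.
have cF : {within `[a, b], continuous (mollified_step s k)}.
  exact/continuous_subspaceT/smooth_continuous.
rewrite (Rintegral_FTC2 ab cF (continuous_subspaceT cd) dF).
rewrite mollified_step1 ?(ltW sb) // mollified_step0 ?subr0 //.
by rewrite (le_trans as_) // lerDl invr_ge0.
Qed.

Lemma mollified_step_average (a b s : R) (f : R -> R) :
  a <= s < b -> {within `[a, b], continuous f} ->
  \int[mu]_(x in `]a, b[) (f x * derive1 (mollified_step s k) x)
    @[k --> \oo] --> f s.
Proof.
move=> /andP[as_ sb] cf; apply/cvgrPdist_le => e e0.
have ab : a < b by exact: le_lt_trans sb.
have fs : f x @[x --> within `[a, b] (nbhs s)] --> f s.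
  have /subspace_continuousP := cf; apply.
  by rewrite /= in_itv /= as_ ltW.
have /cvgrPdist_le/(_ _ e0) := fs; rewrite !near_withinE => -[d /= d0 fd].
have d1 : 0 < Num.min d (b - s) by rewrite lt_min d0 subr_gt0.
near=> k.
have k2 : 2 / k.+1%:R < Num.min d (b - s).
  rewrite mulrC -ltr_pdivlMr //; near: k.
  by have := near_infty_natSinv_lt (PosNum (divr_gt0 d1 (@ltr0Sn R 1))).
move: k2; rewrite lt_min => /andP[kd kb].
have ks : s + 2 / k.+1%:R < b by rewrite addrC -ltrBrDr.
have [fi one] := integral_derive1_mollified_step as_ ks cf.
have [fi1 _] := integral_derive1_mollified_step as_ ks
  (@continuous_subspaceT _ _ _ _ (@cst_continuous _ _ (f s))).
have {}fi1 : mu.-integrable `]a, b[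
    (EFin \o (fun x => f s * derive1 (mollified_step s k) x)) by exact: fi1.
have di : mu.-integrable `]a, b[ (EFin \o derive1 (mollified_step s k)).
  apply: continuous_within_integrable; apply: continuous_subspaceT.
  by apply/smooth_continuous/smooth_derive1/mollified_step_smooth.
rewrite -[f s]mulr1 -one -RintegralZl // -RintegralB //.
have ig : mu.-integrable `]a, b[ (EFin \o (fun x =>
    f s * derive1 (mollified_step s k) x - f x * derive1 (mollified_step s k) x)).
  exact: integrable_EFinB.
apply: (le_trans (le_normr_Rintegral _ ig)) => //.
have -> : e = \int[mu]_(x in `]a, b[) (e * derive1 (mollified_step s k) x).
  by rewrite RintegralZl // one mulr1.
apply: le_Rintegral => //.
- exact: integrable_norm.
- exact: integrable_EFinZl.
move=> x xab; rewrite -mulrBl normrM.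
have m0 : 0 <= derive1 (mollified_step s k) x.
  apply: derive1_nondecreasing_ge0; first exact: mollified_step_homo.
  exact/smooth_derivable/mollified_step_smooth.
rewrite (ger0_norm m0).
have [->|/derive1_mollified_step_support/andP[sx xs]] :=
  eqVneq (derive1 (mollified_step s k) x) 0; first by rewrite !mulr0.
rewrite ler_wpM2r //; apply: fd; last exact: subset_itv_oo_cc.
rewrite /ball /= distrC ger0_norm ?subr_ge0 ?(ltW sx) //.
by apply: le_lt_trans kd; rewrite lerBlDl.
Unshelve. all: by end_near. Qed.

Lemma mollified_step_cvg (s x : R) :
  mollified_step s k x @[k --> \oo] --> ((s < x)%R%:R : R).
Proof.
have [sx|xs] := ltP s x; last first.
  apply: (@cvg_near_cst _ _ _ _ \oo) => //; near=> k.
  by rewrite mollified_step0 // (le_trans xs) // lerDl invr_ge0.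
apply: (@cvg_near_cst _ _ _ _ \oo) => //; near=> k.
rewrite mollified_step1 // addrC -lerBrDr mulrC -ler_pdivlMr //; near: k.
have xs0 : 0 < (x - s) / 2 by rewrite divr_gt0 // subr_gt0.
by have := near_infty_natSinv_lt (PosNum xs0); apply: filterS => k /ltW.
Unshelve. all: by end_near. Qed.

Lemma mollified_test_function (a b s t : R) (k : nat) :
  a <= s -> s <= t -> t + 2 / k.+1%:R < b ->
  test_function a b (fun x => mollified_step s k x - mollified_step t k x).
Proof.
move=> as_ st tb; set phi := fun x => _.
have sub : closure [set x | phi x != 0] `<=`
    `[s + k.+1%:R^-1, t + 2 / k.+1%:R].
  have /closure_id -> : closed `[s + k.+1%:R^-1, t + 2 / k.+1%:R].
    by apply: compact_closed; [exact: Rhausdorff|exact: segment_compact].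
  apply: closure_subset => x /=; rewrite in_itv /=; apply: contraNT.
  rewrite negb_and -!ltNge => /orP[xs|tx]; rewrite /phi.
    by rewrite !mollified_step0 ?subrr // ltW // (lt_le_trans xs) // lerD2r.
  rewrite !mollified_step1 ?subrr // ltW //.
  by apply: le_lt_trans tx; rewrite lerD2r.
split.
- move=> j x; apply: smooth_derive1n => {j} {x} j.
  rewrite (_ : phi = fun x => mollified_step s k x + (-1) * mollified_step t k x).
    apply: Ck_add; first exact: mollified_step_smooth.
    by apply: Ck_mul; [exact: Ck_cst|exact: mollified_step_smooth].
  by apply/funext => x; rewrite mulN1r.
- apply: subclosed_compact sub; first exact: closed_closure.
  exact: segment_compact.
- move=> x /sub /=; rewrite !in_itv /= => /andP[sx xt].
  rewrite (le_lt_trans xt) // andbT; apply: lt_le_trans sx.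
  by apply: (le_lt_trans as_); rewrite ltrDl invr_gt0.
Qed.

Lemma weak_derivative_increment_aux (a b s t : R) (u v : R -> R) :
  a <= s -> s < t -> t < b -> {within `[a, b], continuous u} ->
  mu.-integrable `]a, b[ (EFin \o v) ->
  (forall phi, test_function a b phi ->
    \int[mu]_(x in `]a, b[) (u x * derive1 phi x) =
    - \int[mu]_(x in `]a, b[) (v x * phi x)) ->
  u t - u s = \int[mu]_(x in `]s, t]) v x.
Proof.
move=> as_ st tb cu iv uv.
have sb : s < b by exact: lt_trans tb.
have as_b : a <= s < b by rewrite as_.
have at_b : a <= t < b by rewrite tb (le_trans as_) // ltW.
pose phi k x := mollified_step s k x - mollified_step t k x.
have mu_itv : measurable (`]a, b[ : set R) by [].
have d2 : \forall k \near \oo, t + 2 / k.+1%:R < b.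
  near=> k; rewrite addrC -ltrBrDr mulrC -ltr_pdivlMr //; near: k.
  have bt0 : 0 < (b - t) / 2 by rewrite divr_gt0 // subr_gt0.
  exact: near_infty_natSinv_lt (PosNum bt0).
have lhs : \int[mu]_(x in `]a, b[) (u x * derive1 (phi k) x) @[k --> \oo]
    --> u s - u t.
  apply: cvg_trans (cvgB (mollified_step_average as_b cu)
    (mollified_step_average at_b cu)).
  apply: near_eq_cvg; near=> k.
  have tk : t + 2 / k.+1%:R < b by near: k.
  have sk : s + 2 / k.+1%:R < b by apply: lt_trans tk; rewrite ltrD2r.
  rewrite fctE /= -RintegralB //; last 2 first.
  - by have [] := integral_derive1_mollified_step as_ sk cu.
  - by have [] := integral_derive1_mollified_step (andP at_b).1 tk cu.
  apply: eq_Rintegral => x _; rewrite -mulrBr; congr (_ * _).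
  rewrite !derive1E deriveB //;
    exact/smooth_derivable/mollified_step_smooth.
have rhs : \int[mu]_(x in `]a, b[) (v x * phi k x) @[k --> \oo] -->
    \int[mu]_(x in `]a, b[) (v \_ `]s, t]) x.
  apply: (@Rintegral_dominated_cvg _ _ _ mu _ _ _ (fun x => `|v x|)) => //.
  - move=> k; apply: measurable_funM; first by have /integrableP[/measurable_EFinP] := iv.
    apply: measurable_funTS; apply: measurable_funB;
      apply: continuous_measurable_fun;
      exact/smooth_continuous/mollified_step_smooth.
  - move=> x _; rewrite (_ : (v \_ `]s, t]) x = v x * ((s < x)%R%:R - (t < x)%R%:R)).
      by apply: cvgMr; apply: cvgB; exact: mollified_step_cvg.
    rewrite /patch mem_setE in_itv /= [x <= t]leNgt.
    have [tx|xt] := ltP t x; first by rewrite (lt_trans st tx) subrr mulr0.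
    by rewrite andbT subr0; case: (s < x); rewrite ?mulr1 ?mulr0.
  - exact: integrable_norm.
  - move=> k x _; rewrite normrM ler_piMr //.
    have [/andP[? ?] /andP[? ?]] := (psi_itv (k.+1%:R * (x - s) - 1),
      psi_itv (k.+1%:R * (x - t) - 1)).
    by rewrite /phi /mollified_step ler_norml; lra.
have : u s - u t = - \int[mu]_(x in `]a, b[) (v \_ `]s, t]) x.
  apply: cvg_unique lhs _ => //; apply: cvg_trans (cvgN rhs).
  apply: near_eq_cvg; near=> k; rewrite uv //.
  by apply: mollified_test_function => //; [exact: ltW|near: k].
rewrite -Rintegral_mkcondr => /(congr1 -%R); rewrite opprB opprK => ->.
congr (Rintegral _ _ _); rewrite setIidr //.
by apply: subset_itv; rewrite bnd_simp.
Unshelve. all: by end_near. Qed.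

End WeakDerivative.

Section AbsolutelyContinuous.
Variable R : realType.
Local Notation mu := (@lebesgue_measure R).

Lemma lebesgue_aeS (P Q : R -> Prop) : (forall t, P t -> Q t) ->
  {ae mu, forall t, P t} -> {ae mu, forall t, Q t}.
Proof. exact: (@filterS _ _ (ae_filter_ringOfSetsType mu)). Qed.

Lemma lebesgue_aeI (P Q : R -> Prop) : {ae mu, forall t, P t} ->
  {ae mu, forall t, Q t} -> {ae mu, forall t, P t /\ Q t}.
Proof. exact: (@filterI _ _ (ae_filter_ringOfSetsType mu)). Qed.

Lemma weak_derivative_increment (a b s t : R) (u v : R -> R) :
  a <= s -> s < t -> t < b -> {within `[a, b], continuous u} ->
  mu.-integrable `]a, b[ (EFin \o v) ->
  (forall phi, test_function a b phi ->
    \int[mu]_(x in `]a, b[) (u x * derive1 phi x) =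
    - \int[mu]_(x in `]a, b[) (v x * phi x)) ->
  u t - u s = \int[mu]_(x in `]s, t]) v x.
Proof.
by have [psi [h1 h2 h3 h4 h5]] := smooth_step R; exact: weak_derivative_increment_aux.
Qed.

Lemma increment_ae_derivable (u v : R -> R) :
  (forall k : nat, mu.-integrable `]0, k%:R[ (EFin \o v)) ->
  (forall s t : R, 0 <= s -> s < t -> u t - u s = \int[mu]_(x in `]s, t]) v x) ->
  {ae mu, forall t : R, 0 < t -> is_derive t 1 u (v t)}.
Proof.
move=> iv uv.
have main (k : nat) : {ae mu, forall t : R, 0 < t < k%:R -> is_derive t 1 u (v t)}.
  have mk : measurable (`]0, k%:R[%classic : set R) by [].
  have ir : mu.-integrable setT (EFin \o (v \_ `]0, k%:R[)).
    rewrite -restrict_EFin; apply/integrable_restrict => //.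
    by rewrite setTI.
  have iF y : mu.-integrable [set` Interval (BRight (0 : R)) (BRight y)]
      (EFin \o (v \_ `]0, k%:R[)) by apply: integrableS ir.
  apply: lebesgue_aeS (FTC1 iF (integrable_locally mk (iv k))) => t h /andP[t0 tk].
  have [//|dF F't] := h.
  have Fu : \near t, u 0 + \int[mu]_(x in `]0, t]) (v \_ `]0, k%:R[) x = u t.
    near=> y.
    have y0 : 0 < y by near: y; exact: lt_nbhsr.
    have yk : y < k%:R by near: y; exact: lt_nbhsl.
    rewrite addrC -[RHS](subrK (u 0)) uv //; congr (_ + _).
    apply: eq_Rintegral => x; rewrite inE /= in_itv /= => /andP[x0 xy].
    by rewrite patchE mem_setE in_itv /= x0 (le_lt_trans xy yk).
  apply: (near_eq_is_derive Fu).
  apply: is_derive_eq (is_deriveD (is_derive_cst (u 0) t 1) (derivableP dF)) _.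
  by rewrite add0r -derive1E F't patchE mem_setE in_itv /= t0 tk.
apply: lebesgue_aeS (ae_foralln main) => t h t0.
have [k kt] : exists k : nat, t < k%:R.
  by exists (Num.bound t); apply: archi_boundP (ltW t0).
by apply: (h k); rewrite t0.
Unshelve. all: by end_near. Qed.

End AbsolutelyContinuous.

(** * Truncation of constrained paths *)

Section Truncation.
Variable R : realType.
Local Notation mu := (@lebesgue_measure R).

Definition pospart (x : R) : R := Num.max x 0.

Lemma pospartP (x : R) :
  (pospart x = x /\ 0 <= x) \/ (pospart x = 0 /\ x <= 0).
Proof.
rewrite /pospart; have [x0|x0] := lerP x 0; [right|left]; split=> //.
exact: ltW.
Qed.

Lemma is_derive_sqr_pospart (x : R) :
  is_derive x 1 (fun y => pospart y ^+ 2) (2 * pospart x).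
Proof.
apply: (@is_derive_quadratic_remainder _ _ _ _ 1 1) => // y _.
rewrite ler_norml.
have := sqr_ge0 x; have := sqr_ge0 y; have := sqr_ge0 (y - x).
have [[-> x0]|[-> x0]] := pospartP x; have [[-> y0]|[-> y0]] := pospartP y.
- by lra.
- by have := mulr_ge0_le0 x0 y0; lra.
- by have := mulr_le0_ge0 x0 y0; lra.
- by lra.
Qed.

Lemma pospart_continuous : continuous pospart.
Proof.
by move=> x; apply: continuous_max; [exact: cvg_id|exact: cvg_cst].
Qed.

(* A C^1 approximation of the identity on [0, 1], constant near 0 and near 1,
   which therefore makes sense of the chain rule for a function that is only
   known to be differentiable where its values lie in ]0, 1[. *)
Definition truncation (d x : R) : R :=
  (2 * d)^-1 * (pospart (x - d) ^+ 2 - pospart (x - 2 * d) ^+ 2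
    - pospart (x - 1 + 2 * d) ^+ 2 + pospart (x - 1 + d) ^+ 2).

Definition truncation' (d x : R) : R :=
  d^-1 * (pospart (x - d) - pospart (x - 2 * d)
    - pospart (x - 1 + 2 * d) + pospart (x - 1 + d)).

Lemma is_derive_truncation (d x : R) : 0 < d ->
  is_derive x 1 (truncation d) (truncation' d x).
Proof.
move=> d0.
have sq c : is_derive x 1 (fun y => pospart (y + c) ^+ 2) (2 * pospart (x + c)).
  have dc : is_derive x 1 (fun y : R => y + c) (1 + 0) by exact: is_deriveD.
  have := @is_derive1_comp R (fun y => pospart y ^+ 2) (fun y => y + c) x _ _
    (is_derive_sqr_pospart (x + c)) dc.
  by rewrite addr0 mulr1.
have := is_deriveZ (2 * d)^-1 (is_deriveD (is_deriveB (is_deriveB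
  (sq (- d)) (sq (- (2 * d)))) (sq (- 1 + 2 * d))) (sq (- 1 + d))).
rewrite /truncation /truncation'.
have -> : (fun x => (2 * d)^-1 * (pospart (x - d) ^+ 2 - pospart (x - 2 * d) ^+ 2
    - pospart (x - 1 + 2 * d) ^+ 2 + pospart (x - 1 + d) ^+ 2)) =
  ((2 * d)^-1 \*: ((fun y => pospart (y - d) ^+ 2) - (fun y => pospart (y - 2 * d) ^+ 2)
    - (fun y => pospart (y + (- 1 + 2 * d)) ^+ 2) + (fun y => pospart (y + (- 1 + d)) ^+ 2))).
  by apply/funext => y; rewrite !fctE /GRing.scale /= !addrA.
move=> h; apply: is_derive_eq h _.
by rewrite /GRing.scale /= !addrA; field; rewrite gt_eqF.
Qed.

Lemma truncation'_continuous (d : R) : continuous (truncation' d).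
Proof.
have pc c : continuous (fun y => pospart (y + c)).
  move=> x; apply: (@continuous_comp _ _ _ (fun y => y + c) pospart).
    by apply: cvgD; [exact: cvg_id|exact: cvg_cst].
  exact: pospart_continuous.
move=> x; rewrite /truncation'; apply: cvgM; first exact: cvg_cst.
apply: cvgD; last first.
  by under eq_fun do rewrite -addrA; rewrite -addrA; exact: pc.
apply: cvgB; last first.
  by under eq_fun do rewrite -addrA; rewrite -addrA; exact: pc.
by apply: cvgB; exact: pc.
Qed.

Lemma truncation'_le1 (d x : R) : 0 < d -> `|truncation' d x| <= 1.
Proof.
move=> d0; rewrite normrM normfV (gtr0_norm d0) ler_pdivrMl // mulr1 ler_norml.
case: (pospartP (x - d)) => -[-> ?]; case: (pospartP (x - 2 * d)) => -[-> ?];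
case: (pospartP (x - 1 + 2 * d)) => -[-> ?];
by case: (pospartP (x - 1 + d)) => -[-> ?]; lra.
Qed.

Lemma truncation_approx (d x : R) : 0 < d -> 0 <= x <= 1 ->
  `|truncation d x - x| <= 4 * d.
Proof.
move=> d0 x01; have d20 : 0 < 2 * d by rewrite mulr_gt0.
rewrite /truncation -[X in _ - X](mulKf (lt0r_neq0 d20)) -mulrBr normrM normfV.
rewrite (gtr0_norm d20) ler_pdivrMl // ler_norml.
case: (pospartP (x - d)) => -[-> ?]; case: (pospartP (x - 2 * d)) => -[-> ?];
case: (pospartP (x - 1 + 2 * d)) => -[-> ?];
by case: (pospartP (x - 1 + d)) => -[-> ?]; apply/andP; split; nra.
Qed.

Lemma pospart_ge0 (x : R) : 0 <= x -> pospart x = x.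
Proof. by move=> x0; rewrite /pospart; apply/max_idPl. Qed.

Lemma pospart_le0 (x : R) : x <= 0 -> pospart x = 0.
Proof. by move=> x0; rewrite /pospart; apply/max_idPr. Qed.

Lemma truncation_low (d x : R) : 0 < d -> 4 * d <= 1 -> x <= d ->
  truncation d x = 0 /\ truncation' d x = 0.
Proof.
by move=> d0 d1 xd; rewrite /truncation /truncation' !pospart_le0; lra.
Qed.

Lemma truncation_high (d x : R) : 0 < d -> 4 * d <= 1 -> 1 - d <= x ->
  truncation d x = 1 - 3 * d /\ truncation' d x = 0.
Proof.
move=> d0 d1 xd; rewrite /truncation /truncation' !pospart_ge0; try lra.
by split; field; rewrite gt_eqF.
Qed.

Lemma truncation'_mid (d x : R) : 0 < d -> 2 * d <= x <= 1 - 2 * d ->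
  truncation' d x = 1.
Proof.
move=> d0 xd; rewrite /truncation' (@pospart_ge0 (x - d)); last by lra.
rewrite (@pospart_ge0 (x - 2 * d)); last by lra.
rewrite !pospart_le0; try lra.
by field; rewrite gt_eqF.
Qed.

Lemma truncation'_cvg (x : R) : 0 <= x <= 1 ->
  truncation' k.+1%:R^-1 x @[k --> \oo] --> ((0 < x < 1)%R%:R : R).
Proof.
move=> /andP[x0 x1]; apply: (@cvg_near_cst _ _ _ _ \oo) => //.
have d4 : \forall k \near \oo, 4 * k.+1%:R^-1 <= 1 :> R.
  have q : 0 < 4^-1 :> R by rewrite invr_gt0.
  by near do rewrite mulrC -ler_pdivlMr // mul1r ltW //;
    exact: near_infty_natSinv_lt (PosNum q).
have d0 k : 0 < k.+1%:R^-1 :> R by rewrite invr_gt0.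
have [x0'|x0'] := ltrP 0 x; last first.
  near=> k; rewrite (truncation_low (d0 k) _ _).2 //; first by near: k.
  by rewrite (le_trans x0') // ltW.
have [x1'|x1'] := ltrP x 1; last first.
  near=> k; rewrite (truncation_high (d0 k) _ _).2 //; first by near: k.
  by rewrite (le_trans _ x1') // gerBl ltW.
have m0 : 0 < Num.min x (1 - x) / 2 by rewrite divr_gt0 // lt_min x0' subr_gt0.
near=> k; apply: truncation'_mid => //.
have : k.+1%:R^-1 < Num.min x (1 - x) / 2.
  by near: k; exact: near_infty_natSinv_lt (PosNum m0).
by move: (k.+1%:R^-1) => d; rewrite ltr_pdivlMr // lt_min => /andP[]; lra.
Unshelve. all: by end_near. Qed.

Lemma truncation_cvg (x : R) : 0 <= x <= 1 ->
  truncation k.+1%:R^-1 x @[k --> \oo] --> x.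
Proof.
move=> x01; apply/cvgrPdist_le => e e0; near=> k.
rewrite distrC; apply: (le_trans (truncation_approx _ x01)); first by rewrite invr_gt0.
rewrite mulrC -ler_pdivlMr // ltW //; near: k.
have e4 : 0 < e / 4 by rewrite divr_gt0.
exact: near_infty_natSinv_lt (PosNum e4).
Unshelve. all: by end_near. Qed.

Section ConstrainedPath.
Variables u g : R -> R.
Hypotheses (cu : continuous u) (cg : continuous g).
Hypothesis u01 : forall t, 0 <= u t <= 1.

Definition free_speed (t : R) : R := if 0 < u t < 1 then g t else 0.

Lemma free_speed_cvg (t : R) :
  truncation' k.+1%:R^-1 (u t) * g t @[k --> \oo] --> free_speed t.
Proof.
have -> : free_speed t = (0 < u t < 1)%R%:R * g t.
  by rewrite /free_speed; case: ifP; rewrite ?mul1r ?mul0r.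
by apply: cvgMl; exact: truncation'_cvg.
Qed.

Lemma truncation'_comp_continuous (d : R) :
  continuous (fun t => truncation' d (u t) * g t).
Proof.
move=> t; apply: cvgM; last exact: cg.
by apply: (@continuous_comp _ _ _ u (truncation' d)); [exact: cu|exact: truncation'_continuous].
Qed.

Lemma measurable_free_speed : measurable_fun setT free_speed.
Proof.
apply: (@measurable_fun_cvg _ _ _ setT
  (fun k t => truncation' k.+1%:R^-1 (u t) * g t)).
  by move=> k; apply: continuous_measurable_fun; exact: truncation'_comp_continuous.
by move=> t _; exact: free_speed_cvg.
Qed.

Lemma is_derive_truncation_comp (d t : R) : 0 < d -> 4 * d <= 1 ->
  (0 < u t < 1 -> is_derive t 1 u (g t)) ->
  is_derive t 1 (fun t => truncation d (u t)) (truncation' d (u t) * g t).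
Proof.
move=> d0 d1 ug.
have [/ug dut|nu] := boolP (0 < u t < 1).
  exact: (is_derive1_comp (is_derive_truncation (u t) d0) dut).
have /orP[/eqP ut|/eqP ut] : (u t == 0) || (u t == 1).
  move: nu; have /andP[ut0 ut1] := u01 t.
  by rewrite !lt_neqAle ut0 ut1 !andbT negb_and !negbK eq_sym.
- rewrite (truncation_low d0 d1 _).2 ?ut ?(ltW d0) // mul0r.
  apply: (@near_eq_is_derive _ _ _ (cst (0 : R))).
  near=> s; rewrite (truncation_low d0 d1 _).1 // ltW //; near: s.
  have utd : u t < d by rewrite ut.
  exact: (cvgr_lt (u t) (@cu t) _ utd).
- rewrite (truncation_high d0 d1 _).2 ?ut ?lerBlDr ?lerDl ?(ltW d0) // mul0r.
  apply: (@near_eq_is_derive _ _ _ (cst (1 - 3 * d : R))).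
  near=> s; rewrite (truncation_high d0 d1 _).1 // ltW //; near: s.
  have utd : 1 - d < u t by rewrite ut ltrBlDr ltrDl.
  exact: (cvgr_gt (u t) (@cu t) _ utd).
Unshelve. all: by end_near. Qed.

Lemma free_speed_weak_derivative (a b : R) (phi : R -> R) :
  (forall t, t \in `]a, b[ -> 0 < u t < 1 -> is_derive t 1 u (g t)) ->
  test_function a b phi ->
  \int[mu]_(t in `]a, b[) (u t * derive1 phi t) =
  - \int[mu]_(t in `]a, b[) (free_speed t * phi t).
Proof.
move=> ug [dphi _ sphi].
have [ba|ab] := leP b a.
  by rewrite set_itv_ge ?bnd_simp -?leNgt // !Rintegral_set0 oppr0.
have cphi : continuous phi.
  by move=> t; apply/differentiable_continuous/derivable1_diffP/(dphi 0%N).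
have cphi' : continuous (derive1 phi).
  by move=> t; apply/differentiable_continuous/derivable1_diffP/(dphi 1%N).
have phi0 t : t \notin `]a, b[ -> phi t = 0.
  by apply: contraNeq => pt; apply: sphi; exact: subset_closure.
have cI f : continuous f -> mu.-integrable `]a, b[ (EFin \o f).
  by move=> cf; apply: continuous_within_integrable; exact: continuous_subspaceT.
have cT d : 0 < d -> continuous (fun t => truncation d (u t)).
  move=> d0 t; apply: (@continuous_comp _ _ _ u (truncation d)); first exact: cu.
  have [dt _] := is_derive_truncation (u t) d0.
  exact/differentiable_continuous/derivable1_diffP.
have parts d : 0 < d -> 4 * d <= 1 ->
    \int[mu]_(t in `]a, b[) (truncation d (u t) * derive1 phi t) =
    - \int[mu]_(t in `]a, b[) (truncation' d (u t) * g t * phi t).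
  move=> d0 d1.
  have c1 : continuous (fun t => truncation d (u t) * derive1 phi t).
    by move=> t; apply: cvgM; [exact: cT|exact: cphi'].
  have c2 : continuous (fun t => truncation' d (u t) * g t * phi t).
    by move=> t; apply: cvgM; [exact: truncation'_comp_continuous|exact: cphi].
  apply/eqP; rewrite -addr_eq0 -RintegralD ?cI //; apply/eqP.
  have dF t : t \in `]a, b[ ->
      is_derive t 1 (fun t => truncation d (u t) * phi t)
        (truncation d (u t) * derive1 phi t + truncation' d (u t) * g t * phi t).
    move=> tab.
    have d2 : is_derive t 1 phi (derive1 phi t).
      by rewrite derive1E; apply/derivableP/(dphi 0%N).
    apply: is_derive_eq (is_deriveM (is_derive_truncation_comp d0 d1 (ug t tab)) d2) _.
    by rewrite /GRing.scale /= [X in _ + X]mulrC.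
  rewrite (@Rintegral_FTC2 _ a b (fun t => truncation d (u t) * phi t)) //.
  - rewrite (phi0 a) ?(phi0 b) ?mulr0 ?subr0 // in_itv /= ltxx ?andbF //.
  - by apply: continuous_subspaceT => t; apply: cvgM; [exact: cT|exact: cphi].
  - by apply: continuous_subspaceT => t; apply: cvgD; [exact: c1|exact: c2].
have lhs : \int[mu]_(t in `]a, b[) (truncation k.+1%:R^-1 (u t) * derive1 phi t)
    @[k --> \oo] --> \int[mu]_(t in `]a, b[) (u t * derive1 phi t).
  apply: (@Rintegral_dominated_cvg _ _ _ mu _ _ _ (fun t => 5 * `|derive1 phi t|)) => //.
  - move=> k; apply: measurable_funTS; apply: continuous_measurable_fun => t.
    by apply: cvgM; [apply: cT; rewrite invr_gt0|exact: cphi'].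
  - by move=> t _; apply: cvgMl; exact: truncation_cvg.
  - apply: integrable_EFinZl => //; apply: cI => t.
    by apply: (@continuous_comp _ _ _ (derive1 phi) Num.norm);
      [exact: cphi'|exact: norm_continuous].
  - move=> k t _; rewrite normrM ler_wpM2r //.
    have k0 : 0 < k.+1%:R^-1 :> R by rewrite invr_gt0.
    have k1 : k.+1%:R^-1 <= 1 :> R by rewrite invf_le1 // ler1n.
    have := truncation_approx k0 (u01 t); have := u01 t.
    move: (k.+1%:R^-1) k0 k1 => d k0 k1; move: (truncation d (u t)) => y.
    by rewrite !ler_norml; lra.
have rhs : \int[mu]_(t in `]a, b[) (truncation' k.+1%:R^-1 (u t) * g t * phi t)
    @[k --> \oo] --> \int[mu]_(t in `]a, b[) (free_speed t * phi t).
  apply: (@Rintegral_dominated_cvg _ _ _ mu _ _ _ (fun t => `|g t * phi t|)) => //.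
  - move=> k; apply: measurable_funTS; apply: continuous_measurable_fun => t.
    by apply: cvgM; [exact: truncation'_comp_continuous|exact: cphi].
  - by move=> t _; apply: cvgMl; exact: free_speed_cvg.
  - apply: integrable_norm; apply: cI => t.
    by apply: cvgM; [exact: cg|exact: cphi].
  - by move=> k t _; rewrite -mulrA normrM ler_piMl // truncation'_le1.
apply: cvg_unique lhs _ => //; apply: cvg_trans (cvgN rhs).
apply: near_eq_cvg; near=> k; rewrite fctE /= parts ?invr_gt0 //.
have k4 : k.+1%:R^-1 < 4^-1 :> R.
  by near: k; exact: near_infty_natSinv_lt (PosNum _).
by move: (k.+1%:R^-1) k4 => d; lra.
Unshelve. all: by end_near. Qed.

End ConstrainedPath.

End Truncation.

(** * Comparison of the scheme with a weak solution *)

Section IntegralInequalities.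
Variable R : realType.
Local Notation mu := (@lebesgue_measure R).

Lemma ae_le_Rintegral (D : set R) (f g : R -> R) : measurable D ->
  mu.-integrable D (EFin \o f) -> mu.-integrable D (EFin \o g) ->
  {ae mu, forall x, D x -> f x <= g x} ->
  \int[mu]_(x in D) f x <= \int[mu]_(x in D) g x.
Proof.
move=> mD fi gi fg; rewrite -subr_ge0 -RintegralB //.
have gfi : mu.-integrable D (EFin \o (fun x => g x - f x)) by exact: integrable_EFinB.
have -> : \int[mu]_(x in D) (g x - f x) = \int[mu]_(x in D) `|g x - f x|.
  rewrite /Rintegral; congr fine; apply: ae_eq_integral => //.
  - by have /integrableP[] := gfi.
  - have : mu.-integrable D (EFin \o (fun x => `|g x - f x|)) by exact: integrable_norm.
    by case/integrableP.
  - by apply: lebesgue_aeS fg => x h Dx /=; rewrite ger0_norm // subr_ge0 h.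
exact: Rintegral_ge0.
Qed.

Lemma subset_Rintegral (A B : set R) (f : R -> R) : measurable A ->
  measurable B -> A `<=` B -> mu.-integrable B (EFin \o f) ->
  (forall x, 0 <= f x) -> \int[mu]_(x in A) f x <= \int[mu]_(x in B) f x.
Proof.
move=> mA mB AB fi f0; apply: fine_le.
- by apply: integrable_fin_num => //; exact: integrableS fi.
- exact: integrable_fin_num.
- apply: ge0_subset_integral => //; first by have /integrableP[] := fi.
  by move=> x _; rewrite lee_fin.
Qed.

Lemma Rintegral_cst_itv (s t c : R) : s <= t ->
  \int[mu]_(x in `]s, t]) c = c * (t - s).
Proof.
move=> st; rewrite Rintegral_cst //; congr (_ * _).
suff h : mu `]s, t]%classic = (t - s)%:E by exact: (congr1 fine h).
rewrite lebesgue_measure_itv /= lte_fin.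
by case: ltgtP st => // -> _; rewrite subrr.
Qed.

Lemma integrable_cst_itv (s t c : R) :
  mu.-integrable `]s, t] (EFin \o (fun=> c)).
Proof.
apply: (@integrableS _ _ _ mu `[s, t]%classic) => //.
  by apply: subset_itv; rewrite bnd_simp.
apply: continuous_compact_integrable; first exact: segment_compact.
by apply: continuous_subspaceT => x; exact: cvg_cst.
Qed.

Lemma sqr_Rintegral_le (s t : R) (f : R -> R) : s < t ->
  mu.-integrable `]s, t] (EFin \o f) ->
  mu.-integrable `]s, t] (EFin \o (fun x => f x ^+ 2)) ->
  (\int[mu]_(x in `]s, t]) f x) ^+ 2 <= (t - s) * \int[mu]_(x in `]s, t]) (f x ^+ 2).
Proof.
move=> st fi f2i; set F := Rintegral _ _ _.
have ts0 : 0 < t - s by rewrite subr_gt0.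
pose c := F / (t - s).
have : \int[mu]_(x in `]s, t]) (2 * c * f x - c ^+ 2) <= \int[mu]_(x in `]s, t]) (f x ^+ 2).
  apply: le_Rintegral => //.
    by apply: integrable_EFinB (integrable_cst_itv _ _ _) => //; exact: integrable_EFinZl.
  by move=> x _; have := sqr_ge0 (f x - c); rewrite sqrrB; lra.
rewrite RintegralB //; last 2 first.
- exact: integrable_EFinZl.
- exact: integrable_cst_itv.
rewrite RintegralZl // Rintegral_cst_itv ?(ltW st) // -/F => h.
rewrite -ler_pdivrMl //; apply: le_trans h.
by rewrite le_eqVlt /c; apply/orP; left; apply/eqP; field; rewrite gt_eqF.
Qed.

Lemma ae_affine_Rintegral_le (s t z c p q : R) (f g : R -> R) : s <= t ->
  mu.-integrable `]s, t] (EFin \o f) -> mu.-integrable `]s, t] (EFin \o g) ->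
  {ae mu, forall x, s < x <= t -> z * (f x + c) <= p * g x + q} ->
  z * (\int[mu]_(x in `]s, t]) f x + c * (t - s)) <=
    p * \int[mu]_(x in `]s, t]) g x + q * (t - s).
Proof.
move=> st fi gi fg.
have ci := integrable_cst_itv s t.
have fci : mu.-integrable `]s, t] (EFin \o (fun x => f x + c)).
  exact: integrable_EFinD.
have pgi : mu.-integrable `]s, t] (EFin \o (fun x => p * g x)).
  exact: integrable_EFinZl.
rewrite -!Rintegral_cst_itv // -RintegralD // -RintegralZl //.
rewrite -RintegralZl // -RintegralD //.
have zi : mu.-integrable `]s, t] (EFin \o (fun x => z * (f x + c))).
  exact: integrable_EFinZl.
have pqi : mu.-integrable `]s, t] (EFin \o (fun x => p * g x + q)).
  exact: integrable_EFinD.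
by apply: ae_le_Rintegral.
Qed.

End IntegralInequalities.

Section Comparison.
Variables (R : realType) (n : nat) (h : 'cV[R]_n -> 'cV[R]_n) (L K H : R).
Local Notation mu := (@lebesgue_measure R).
Hypotheses (L0 : 0 <= L) (K0 : 0 <= K) (H0 : 0 <= H).
Hypothesis hL : lipschitz_field L h.
Hypothesis hH : forall x, unit_valued x -> forall i, `|h x i 0| <= H.

Variables (U v B : R -> 'cV[R]_n) (W : R -> R).
Hypothesis U01 : forall t, 0 <= t -> unit_valued (U t).
Hypothesis Uv : forall i s t, 0 <= s -> s < t ->
  U t i 0 - U s i 0 = \int[mu]_(x in `]s, t]) v x i 0.
Hypothesis v_int : forall i s t, 0 <= s ->
  mu.-integrable `]s, t] (EFin \o (fun x => v x i 0)).
Hypothesis W_int : forall s t, 0 <= s -> mu.-integrable `]s, t] (EFin \o W).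
Hypothesis W2_int : forall s t, 0 <= s ->
  mu.-integrable `]s, t] (EFin \o (fun x => W x ^+ 2)).
Hypothesis W1 : forall x, 1 <= W x.
Hypothesis vW : forall i x, `|v x i 0| <= W x.
Hypothesis vB : {ae mu, forall t : R, 0 <= t -> forall i,
  [/\ v t i 0 = B t i 0 - h (U t) i 0, U t i 0 < 1 -> 0 <= B t i 0
    & 0 < U t i 0 -> B t i 0 <= 0]}.

Lemma increment_bound (s t x y : R) (i : 'I_n) : 0 <= s ->
  s <= x -> x <= y -> y <= t ->
  `|U y i 0 - U x i 0| <= \int[mu]_(x in `]s, t]) W x.
Proof.
move=> s0 sx xy yt; have x0 := le_trans s0 sx.
have W0 z : 0 <= W z by exact: le_trans (W1 z).
move: xy; rewrite le_eqVlt => /predU1P[->|xy].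
  by rewrite subrr normr0; exact: Rintegral_ge0.
rewrite (Uv _ x0 xy); apply: (le_trans (le_normr_Rintegral _ _)) => //.
  exact: v_int.
apply: (@le_trans _ _ (\int[mu]_(x in `]x, y]) W x)).
  apply: le_Rintegral => //; last exact: W_int.
  by apply: integrable_norm; exact: v_int.
apply: subset_Rintegral => //; last exact: W_int.
by apply: subset_itv; rewrite bnd_simp.
Qed.

Variables (tau : R) (u b : nat -> 'cV[R]_n).
Hypotheses (tau0 : 0 < tau) (tau1 : tau <= 1).
Hypothesis hub : obstacle_euler h K tau u b.
Hypothesis U0 : U 0 = u 0%N.

Let grid (m : nat) : R := m%:R * tau.
Let gap (m : nat) (i : 'I_n) : R := U (grid m) i 0 - u m i 0.
Let gap2 (m : nat) : R := \sum_i gap m i ^+ 2.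
Let rate : R := n%:R * (2 * ((1 + 2 * H + 2 * K) + 2 * L * (1 + K) + K)).

Lemma gap_step (m : nat) :
  gap2 m.+1 <= (1 + rate * tau) * gap2 m
    + rate * tau * \int[mu]_(x in `](grid m), (grid m.+1)]) (W x ^+ 2).
Proof.
have g0 : 0 <= grid m by rewrite mulr_ge0 // ltW.
have gS : grid m.+1 = grid m + tau by rewrite /grid -natr1; ring.
have gS' : grid m < grid m.+1 by rewrite gS ltrDl.
have g1 : 0 <= grid m.+1 by rewrite ltW // (le_lt_trans g0).
set Q := \int[mu]_(x in _) (W x ^+ 2).
set D := \int[mu]_(x in `](grid m), (grid m.+1)]) W x.
set d := Num.sqrt (gap2 m).
have Z0 : 0 <= gap2 m by apply: sumr_ge0 => i _; exact: sqr_ge0.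
have d0 : 0 <= d by exact: sqrtr_ge0.
have d2 : d ^+ 2 = gap2 m by rewrite sqr_sqrtr.
have gd j : `|gap m j| <= d.
  rewrite -sqrtr_sqr ler_wsqrtr // /gap2 (bigD1 j) //= lerDl.
  by apply: sumr_ge0 => i _; exact: sqr_ge0.
have Dtau : tau <= D.
  have -> : tau = \int[mu]_(x in `](grid m), (grid m.+1)]) (1 : R).
    by rewrite Rintegral_cst_itv ?(ltW gS') // gS; ring.
  apply: le_Rintegral => //; [exact: integrable_cst_itv|exact: W_int].
have D0 : 0 <= D by apply: le_trans Dtau; exact: ltW.
have DQ : D ^+ 2 <= tau * Q.
  have -> : tau = grid m.+1 - grid m by rewrite gS; ring.
  by apply: sqr_Rintegral_le => //; [exact: W_int|exact: W2_int].
have one i : gap m.+1 i ^+ 2 - gap m i ^+ 2 <=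
    2 * ((1 + 2 * H + 2 * K) + 2 * L * (1 + K) + K) * D ^+ 2
    + 2 * (2 * L * (1 + K)) * tau * gap2 m.
  have [b_ge b_le e lip] := hub.2 m i.
  have bK : `|b m.+1 i 0| <= 2 * K + H.
    by apply: (euler_multiplier_bound K0 tau0 hub) => // k; apply: hH; exact: hub.1.
  have dU x y : grid m <= x -> x <= y -> y <= grid m.+1 ->
      forall j, `|U y j 0 - U x j 0| <= D.
    by move=> mx xy ym j; exact: increment_bound.
  have gap'd : `|gap m.+1 i| <= d + (1 + K) * D.
    have := gd i; have := dU _ _ (lexx _) (ltW gS') (lexx _) i.
    have : K * tau <= K * D by rewrite ler_wpM2l.
    by move: lip; rewrite /gap !ler_norml; lra.
  have gap'1 : `|gap m.+1 i| <= 1.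
    have := U01 g1 i; have := hub.1 m.+1 i.
    by rewrite /gap ler_norml; lra.
  pose c := h (u m) i 0 - b m.+1 i 0.
  have tE : tau = grid m.+1 - grid m by rewrite gS; ring.
  have main : gap m.+1 i * (\int[mu]_(x in `](grid m), (grid m.+1)]) v x i 0 + c * tau)
      <= (1 + 2 * H + 2 * K) * D * D + 2 * L * (1 + K) * (d ^+ 2 + D ^+ 2) * tau.
    rewrite [in X in X <= _]tE [X in _ <= _ + _ * X]tE.
    apply: ae_affine_Rintegral_le; [exact: ltW|exact: v_int|exact: W_int|].
    apply: lebesgue_aeS vB => x hx /andP[gx xg].
    have x0 : 0 <= x by rewrite (le_trans g0) // ltW.
    have [vE B_ge B_le] := hx x0 i.
    have hUu : `|h (u m) i 0 - h (U x) i 0| <= L * (d + D).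
      apply: hL => j; have := dU _ _ (lexx _) (ltW gx) xg j; have := gd j.
      by rewrite /gap !ler_norml; lra.
    have sgn : (U x i 0 - u m.+1 i 0) * (B x i 0 - b m.+1 i 0) <= 0.
      have /andP[Ux0 Ux1] := U01 x0 i; have /andP[ux0 ux1] := hub.1 m.+1 i.
      have [lt|gt|->] := ltgtP (U x i 0) (u m.+1 i 0); last by rewrite subrr mul0r.
      - rewrite mulr_le0_ge0 ?subr_le0 ?(ltW lt) // subr_ge0.
        by rewrite (le_trans (b_le _)) ?B_ge // ?(le_lt_trans Ux0) ?(lt_le_trans lt).
      - rewrite mulr_ge0_le0 ?subr_ge0 ?(ltW gt) // subr_le0.
        by rewrite (le_trans (B_le _)) ?b_ge // ?(le_lt_trans ux0) ?(lt_le_trans gt).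
    have dUx : `|U (grid m.+1) i 0 - U x i 0| <= D by apply: dU; rewrite ?(ltW gx).
    have Bb : `|B x i 0 - b m.+1 i 0| <= (1 + 2 * H + 2 * K) * W x.
      have := vW i x; have := hH (U01 x0) i.
      have : (2 * H + 2 * K) * 1 <= (2 * H + 2 * K) * W x.
        by rewrite ler_wpM2l // addr_ge0 // mulr_ge0.
      by move: bK vE; rewrite !ler_norml; lra.
    have t1 : (U (grid m.+1) i 0 - U x i 0) * (B x i 0 - b m.+1 i 0) <=
        (1 + 2 * H + 2 * K) * D * W x.
      by apply: (le_trans (ler_norm _)); rewrite normrM mulrC mulrAC ler_pM.
    have t2 : gap m.+1 i * (h (u m) i 0 - h (U x) i 0) <=
        2 * L * (1 + K) * (d ^+ 2 + D ^+ 2).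
      apply: (le_trans (ler_norm _)); rewrite normrM.
      apply: (@le_trans _ _ ((d + (1 + K) * D) * (L * (d + D)))); first exact: ler_pM.
      have : 0 <= (d - D) ^+ 2 * (L * (1 + K)) by rewrite mulr_ge0 ?sqr_ge0 // mulr_ge0 // addr_ge0.
      have : 0 <= L * K * (d * (d + D)) by rewrite !mulr_ge0 // addr_ge0.
      by lra.
    rewrite vE /c.
    move: sgn t1 t2; rewrite /gap.
    by lra.
  have abs : `|gap m.+1 i * (u m.+1 i 0 - u m i 0 - tau * (b m.+1 i 0 - h (u m) i 0))|
      <= K * D ^+ 2.
    rewrite normrM; apply: le_trans (ler_piMl _ gap'1) _ => //.
    by apply: (le_trans e); rewrite ler_wpM2l // ler_sqr // nnegrE // ltW.
  have incr : \int[mu]_(x in `](grid m), (grid m.+1)]) v x i 0 =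
      gap m.+1 i - gap m i + (u m.+1 i 0 - u m i 0) by rewrite -Uv // /gap; ring.
  have tD : tau * D ^+ 2 <= D ^+ 2 by rewrite ler_piMl ?sqr_ge0.
  have : 2 * L * (1 + K) * (tau * D ^+ 2) <= 2 * L * (1 + K) * D ^+ 2.
    by rewrite ler_wpM2l // !mulr_ge0 // addr_ge0.
  have := sqr_ge0 (gap m.+1 i - gap m i).
  move: main abs; rewrite incr ler_norml d2 /c.
  by lra.
have sum_one : gap2 m.+1 - gap2 m <= n%:R *
    (2 * ((1 + 2 * H + 2 * K) + 2 * L * (1 + K) + K) * D ^+ 2
    + 2 * (2 * L * (1 + K)) * tau * gap2 m).
  rewrite /gap2 -sumrB -[n in n%:R]card_ord -sum1_card natr_sum mulr_suml.
  by apply: ler_sum => i _; rewrite mul1r; exact: one.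
have n0 : 0 <= n%:R :> R by [].
have p0 : 0 <= n%:R * (2 * ((1 + 2 * H + 2 * K) + 2 * L * (1 + K) + K)).
  by repeat first [exact: L0|exact: K0|exact: H0|apply: mulr_ge0|apply: addr_ge0].
have := ler_wpM2l p0 DQ.
have : 0 <= n%:R * (2 * ((1 + 2 * H + 2 * K) + K)) * (tau * gap2 m).
  apply: mulr_ge0; last by rewrite mulr_ge0 // ltW.
  by repeat first [exact: K0|exact: H0|apply: mulr_ge0|apply: addr_ge0].
by move: sum_one; rewrite /rate; lra.
Qed.

Lemma gap2_bound (m : nat) :
  gap2 m <= expR (rate * grid m) * (rate * tau) *
    \int[mu]_(x in `]0, grid m]) (W x ^+ 2).
Proof.
have rate0 : 0 <= rate.
  by repeat first [exact: L0|exact: K0|exact: H0|apply: mulr_ge0|apply: addr_ge0].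
have rt0 : 0 <= rate * tau by rewrite mulr_ge0 // ltW.
elim: m => [|m IH].
  rewrite /gap2 big1; last by move=> i _; rewrite /gap /grid mul0r U0 subrr expr0n.
  apply: mulr_ge0; first by rewrite mulr_ge0 ?expR_ge0.
  by apply: Rintegral_ge0 => x _; exact: sqr_ge0.
apply: le_trans (gap_step m) _.
have g0 : 0 <= grid m by rewrite mulr_ge0 // ltW.
have gS : grid m.+1 = grid m + tau by rewrite /grid -natr1; ring.
have split_int := @Rintegral_itvB R (fun x => W x ^+ 2) (BRight 0) (BRight (grid m.+1))
  (grid m) (W2_int _ (lexx _)).
have {split_int} : \int[mu]_(x in `]0, grid m.+1]) (W x ^+ 2) -
    \int[mu]_(x in `]0, grid m]) (W x ^+ 2) =
    \int[mu]_(x in `](grid m), (grid m.+1)]) (W x ^+ 2).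
  by apply: split_int; rewrite bnd_simp // gS lerDl ltW.
have : 0 <= \int[mu]_(x in `](grid m), (grid m.+1)]) (W x ^+ 2).
  by apply: Rintegral_ge0 => x _; exact: sqr_ge0.
have : 0 <= \int[mu]_(x in `]0, grid m]) (W x ^+ 2).
  by apply: Rintegral_ge0 => x _; exact: sqr_ge0.
move: IH; move: (\int[mu]_(x in `]0, grid m]) (W x ^+ 2))
  (\int[mu]_(x in `](grid m), (grid m.+1)]) (W x ^+ 2))
  (\int[mu]_(x in `]0, grid m.+1]) (W x ^+ 2)) => Q q Q' IH Q0 q0 QE.
have -> : Q' = Q + q by lra.
have E1 : 1 <= expR (rate * grid m.+1).
  by rewrite -expR0 ler_expR mulr_ge0 // gS addr_ge0 // ltW.
have E2 : (1 + rate * tau) * expR (rate * grid m) <= expR (rate * grid m.+1).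
  by rewrite gS mulrDr expRD mulrC ler_wpM2l ?expR_ge0 // expR_ge1Dx.
rewrite mulrDr; apply: lerD; last first.
  by rewrite ler_wpM2r // ler_peMl.
apply: (@le_trans _ _ ((1 + rate * tau) * (expR (rate * grid m) * (rate * tau) * Q))).
  by rewrite ler_wpM2l // addr_ge0.
by rewrite mulrA [X in X * _ <= _]mulrA ler_wpM2r // ler_wpM2r.
Qed.

Lemma euler_error (t : R) (i : 'I_n) : 0 <= t ->
  (u (step_index t tau) i 0 - U t i 0) ^+ 2 <=
  2 * ((expR (rate * (t + 1)) * rate + 1) *
    \int[mu]_(x in `]0, t + 1]) (W x ^+ 2)) * tau.
Proof.
move=> t0; set m := step_index t tau; set I := Rintegral _ _ _.
have /andP[tm mt] : t <= grid m < t + tau by exact: step_index_bounds.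
have g0 : 0 <= grid m by exact: le_trans tm.
have gt1 : grid m <= t + 1 by rewrite (le_trans (ltW mt)) // lerD2l.
have rate0 : 0 <= rate.
  by repeat first [exact: L0|exact: K0|exact: H0|apply: mulr_ge0|apply: addr_ge0].
have I0 : 0 <= I by apply: Rintegral_ge0 => x _; exact: sqr_ge0.
have sub s s' : 0 <= s -> s' <= t + 1 ->
    \int[mu]_(x in `]s, s']) (W x ^+ 2) <= I.
  move=> s0 s't; apply: subset_Rintegral => //; last 2 first.
  - exact: W2_int.
  - by move=> x; exact: sqr_ge0.
  by apply: subset_itv; rewrite bnd_simp.
have h1 : (U (grid m) i 0 - U t i 0) ^+ 2 <= tau * I.
  move: tm; rewrite le_eqVlt => /predU1P[<-|tm].
    by rewrite subrr expr0n mulr_ge0 // ltW.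
  have bd := increment_bound i t0 (lexx t) (ltW tm) (lexx _).
  apply: (@le_trans _ _ ((\int[mu]_(x in `]t, grid m]) W x) ^+ 2)).
    rewrite -[X in X <= _]real_normK ?num_real //.
    by apply: lerXn2r; rewrite ?nnegrE //; exact: le_trans bd.
  apply: (le_trans (sqr_Rintegral_le tm (W_int _ t0) (W2_int _ t0))).
  apply: ler_pM; [by rewrite subr_ge0 ltW| |by rewrite lerBlDl ltW|exact: sub].
  by apply: Rintegral_ge0 => x _; exact: sqr_ge0.
have h2 : gap m i ^+ 2 <= expR (rate * (t + 1)) * (rate * tau) * I.
  apply: (@le_trans _ _ (gap2 m)).
    by rewrite /gap2 (bigD1 i) //= lerDl; apply: sumr_ge0 => j _; exact: sqr_ge0.
  apply: (le_trans (gap2_bound m)); apply: ler_pM.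
  - by rewrite mulr_ge0 ?expR_ge0 // mulr_ge0 // ltW.
  - by apply: Rintegral_ge0 => x _; exact: sqr_ge0.
  - by apply: ler_wpM2r; rewrite ?ler_expR ?ler_wpM2l // mulr_ge0 // ltW.
  - exact: sub.
have := sqr_ge0 (gap m i + (U (grid m) i 0 - U t i 0)).
have -> : u m i 0 - U t i 0 = (U (grid m) i 0 - U t i 0) - gap m i by rewrite /gap; ring.
by move: h1 h2; nra.
Qed.

End Comparison.

(** * Limits of the scheme *)

Lemma ultra_cvg_itv (R : realType) (F : set_system nat) (f : nat -> R)
    (a b : R) : UltraFilter F -> (forall k, a <= f k <= b) ->
  exists l : R, f k @[k --> F] --> l.
Proof.
move=> FU fab.
have [|p [_ clp]] := @segment_compact R a b (f @ F) _.
  suff : \forall k \near F, f k \in `[a, b] by [].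
  by apply: nearW => k; rewrite in_itv /=; exact: fab.
exists p => A pA.
have [//|FnA] := in_ultra_setVsetC (f @^-1` A) FU.
have [x [nAx Ax]] := clp (~` A) A FnA pA.
by [].
Qed.

Lemma step_index_homo (R : realType) (s t tau : R) :
  0 < tau -> 0 <= s -> s <= t -> (step_index s tau <= step_index t tau)%N.
Proof.
move=> tau0 s0 st; have /andP[_ h1] := step_index_bounds s0 tau0.
have /andP[h2 _] := step_index_bounds (le_trans s0 st) tau0.
rewrite -ltnS -(ltr_nat R) -(ltr_pM2r tau0) -natr1 mulrDl mul1r.
by apply: lt_le_trans h1 _; rewrite lerD2r (le_trans st).
Qed.

Lemma is_derive_littleo (R : realType) (f : R -> R) (x d e : R) :
  is_derive x 1 f d -> 0 < e ->
  exists2 r, 0 < r & forall y, `|y - x| < r ->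
    `|f y - f x - (y - x) * d| <= e * `|y - x|.
Proof.
move=> [df <-] e0; have /cvgrPdist_le/(_ _ e0) := df.
rewrite near_withinE => -[r /= r0 hr]; exists r => // y yx.
have [->|xy] := eqVneq y x; first by rewrite !subrr mul0r subrr normr0 mulr0.
have yx0 : y - x != 0 by rewrite subr_eq0.
have := hr (y - x); rewrite /= sub0r normrN => /(_ yx yx0).
rewrite [(y - x) *: 1]mulr1 subrK /GRing.scale /= -/(derive f x 1) => h.
rewrite -ler_pdivrMr ?normr_gt0 // -normfV -normrM.
move: h; rewrite distrC; congr (`|_| <= _).
by rewrite mulrBl (mulrC (y - x)) mulfK // mulrC.
Qed.

Lemma is_derive_ge (R : realType) (f : R -> R) (t d c C r : R) :
  is_derive t 1 f d -> 0 < r ->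
  (forall s, t < s -> s < t + r -> (s - t) * c - C * (s - t) ^+ 2 <= f s - f t) ->
  c <= d.
Proof.
move=> fd r0 fc; rewrite leNgt; apply/negP => dc.
have e0 : 0 < (c - d) / 4 by rewrite divr_gt0 // subr_gt0.
have [r' r'0 hr'] := is_derive_littleo fd e0.
pose C' := `|C| + 1; have C'0 : 0 < C' by rewrite ltr_wpDl.
pose m := Num.min (Num.min r r') ((c - d) / C') / 2.
have m0 : 0 < m by rewrite divr_gt0 // !lt_min r0 r'0 divr_gt0 // subr_gt0.
have : m * 2 <= Num.min (Num.min r r') ((c - d) / C') by rewrite divfK.
rewrite !le_min => /andP[/andP[mr mr'] mC].
have := fc (t + m); rewrite ltrDl ltrD2l [t + m]addrC addrK => /(_ m0).
have mr2 : m < r by lra.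
move=> /(_ mr2) h1.
have := hr' (m + t); rewrite addrK gtr0_norm // => h2.
have {}h2 := h2 (ltac:(lra) : m < r').
move: mC; rewrite ler_pdivlMr // => mC.
have CC : C <= C' by rewrite /C'; have := ler_norm C; lra.
have mCm : m * C <= m * C' by rewrite ler_pM2l.
by move: h2; rewrite ler_norml; nra.
Qed.

Lemma is_derive_le (R : realType) (f : R -> R) (t d c C r : R) :
  is_derive t 1 f d -> 0 < r ->
  (forall s, s < t -> t - r < s -> f t - f s <= (t - s) * c + C * (t - s) ^+ 2) ->
  d <= c.
Proof.
move=> fd r0 fc.
have gd : is_derive (- t) 1 (fun x => f (- x)) (- d).
  have dN : is_derive (- t) 1 (fun x : R => - x) (- 1) by exact: is_deriveN.
  have fd' : is_derive (- (- t)) 1 f d by rewrite opprK.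
  have := @is_derive1_comp R f -%R (- t) _ _ fd' dN.
  by rewrite mulrN1.
rewrite -lerN2; apply: (@is_derive_ge _ _ _ _ _ C r gd r0) => s ts sr.
have := fc (- s); rewrite !opprK => /(_ (ltac:(lra)) (ltac:(lra))).
by lra.
Qed.

Section DiscreteLimit.
Variables (R : realType) (n : nat) (L K : R).
Hypotheses (L0 : 0 <= L) (K0 : 0 <= K).

Lemma lipschitz_field_cvg (F : set_system nat) (h : 'cV[R]_n -> 'cV[R]_n)
    (x : nat -> 'cV[R]_n) (y : 'cV[R]_n) (i : 'I_n) : Filter F ->
  lipschitz_field L h -> (forall j, x k j 0 @[k --> F] --> y j 0) ->
  h (x k) i 0 @[k --> F] --> h y i 0.
Proof.
move=> FF hL xy; apply/cvgrPdist_le => e e0.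
have L1 : 0 < L + 1 by rewrite ltr_wpDl.
have d0 : 0 < e / (L + 1) by rewrite divr_gt0.
have : \forall k \near F, forall j, `|y j 0 - x k j 0| <= e / (L + 1).
  by apply: filter_forall => j; have /cvgrPdist_le := xy j; exact.
apply: filterS => k hk; apply: (le_trans (hL _ _ _ hk i)).
by rewrite mulrCA ler_piMr ?(ltW e0) // ler_pdivrMr // mul1r lerDl.
Qed.

(* An ultrafilter limit of the scheme exists without extracting subsequences,
   and so does a limit along all of nat once it is known to be the solution ;
   F covers both. *)
Variables (F : set_system nat) (tau : nat -> R).
Hypothesis FF : ProperFilter F.
Hypothesis tau0 : forall k, 0 < tau k.
Hypothesis tauF : tau k @[k --> F] --> (0 : R).

Lemma grid_cvg (t : R) : 0 <= t ->
  (step_index t (tau k))%:R * tau k @[k --> F] --> t.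
Proof.
move=> t0; apply: (@squeeze_cvgr _ _ _ _ (fun=> t) (fun k => t + tau k)).
- by apply: nearW => k; have /andP[-> /ltW ->] := step_index_bounds t0 (tau0 k).
- exact: cvg_cst.
- by rewrite -[X in _ --> X]addr0; apply: cvgD; [exact: cvg_cst|exact: tauF].
Qed.

Definition grid_value (u : nat -> nat -> 'cV[R]_n) (t : R) (k : nat) : 'cV[R]_n :=
  u k (step_index t (tau k)).

Definition discrete_limit (u : nat -> nat -> 'cV[R]_n) (U : R -> 'cV[R]_n) :=
  forall t, 0 <= t -> forall i, grid_value u t k i 0 @[k --> F] --> U t i 0.

Lemma discrete_limit_lipschitz (h : 'cV[R]_n -> 'cV[R]_n)
    (u b : nat -> nat -> 'cV[R]_n) (U : R -> 'cV[R]_n) :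
  (forall k, obstacle_euler h K (tau k) (u k) (b k)) -> discrete_limit u U ->
  forall s t i, 0 <= s -> 0 <= t -> `|U t i 0 - U s i 0| <= K * `|t - s|.
Proof.
move=> hub uU s t i s0 t0.
apply: (@ler_cvg_to _ F FF R (fun k => `|grid_value u t k i 0 - grid_value u s k i 0|)
  (fun k => K * `|(step_index t (tau k))%:R * tau k - (step_index s (tau k))%:R * tau k|)).
- by apply: cvg_norm; apply: cvgB; exact: uU.
- by apply: cvgMr; apply: cvg_norm; apply: cvgB; exact: grid_cvg.
- by apply: nearW => k; exact: (euler_lipschitz K0 (hub k)).
Qed.

Lemma discrete_limit_unit_valued (h : 'cV[R]_n -> 'cV[R]_n)
    (u b : nat -> nat -> 'cV[R]_n) (U : R -> 'cV[R]_n) :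
  (forall k, obstacle_euler h K (tau k) (u k) (b k)) -> discrete_limit u U ->
  forall t, 0 <= t -> unit_valued (U t).
Proof.
move=> hub uU t t0 i; apply/andP; split.
- apply: (cvgr_to_ge (uU t t0 i)); apply: nearW => k.
  by have /andP[] := (hub k).1 (step_index t (tau k)) i.
- apply: (cvgr_to_le (uU t t0 i)); apply: nearW => k.
  by have /andP[] := (hub k).1 (step_index t (tau k)) i.
Qed.

Lemma discrete_limit_lower_bound (h : 'cV[R]_n -> 'cV[R]_n)
    (u b : nat -> nat -> 'cV[R]_n) (U : R -> 'cV[R]_n) :
  lipschitz_field L h ->
  (forall k, obstacle_euler h K (tau k) (u k) (b k)) -> discrete_limit u U ->
  forall s t i, 0 <= s -> s <= t -> U s i 0 + K * (t - s) < 1 ->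
    - (t - s) * h (U s) i 0 - L * K * (t - s) ^+ 2 <= U t i 0 - U s i 0.
Proof.
move=> hL hub uU s t i s0 st lt1; have t0 := le_trans s0 st.
pose p k := (step_index t (tau k) - step_index s (tau k))%N.
have pE k : (p k)%:R * tau k =
    (step_index t (tau k))%:R * tau k - (step_index s (tau k))%:R * tau k.
  by rewrite natrB ?mulrBl //; exact: step_index_homo.
have pc : (p k)%:R * tau k @[k --> F] --> t - s.
  under eq_fun do rewrite pE.
  by apply: cvgB; exact: grid_cvg.
have hc : h (grid_value u s k) i 0 @[k --> F] --> h (U s) i 0.
  exact: lipschitz_field_cvg hL (uU s s0).
apply: (@ler_cvg_to _ F FF R
  (fun k => - ((p k)%:R * tau k) * h (grid_value u s k) i 0
     - (L * K * ((p k)%:R * tau k) ^+ 2 + K * tau k * ((p k)%:R * tau k)))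
  (fun k => grid_value u t k i 0 - grid_value u s k i 0)).
- apply: cvgB; first by apply: cvgM => //; exact: cvgN.
  rewrite -[X in _ --> X]addr0; apply: cvgD.
    apply: cvgMr; rewrite expr2; under eq_fun do rewrite expr2; exact: cvgM.
  rewrite -[X in _ --> X](mul0r (t - s)); apply: cvgM => //.
  by rewrite -[X in _ --> X](mulr0 K); exact: cvgMr.
- by apply: cvgB; exact: uU.
- have : \forall k \near F, grid_value u s k i 0 + K * ((p k)%:R * tau k) < 1.
    apply: (@cvgr_lt _ _ _ _ _ (U s i 0 + K * (t - s))) => //.
    by apply: cvgD; [exact: uU|exact: cvgMr].
  apply: filterS => k hk.
  have := euler_lower_bound L0 K0 (tau0 k) hL (hub k) hk.
  by rewrite subnKC //; exact: step_index_homo.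
Qed.

Lemma reflect_discrete_limit (u : nat -> nat -> 'cV[R]_n) (U : R -> 'cV[R]_n) :
  discrete_limit u U ->
  discrete_limit (fun k m => const_mx 1 - u k m) (fun t => const_mx 1 - U t).
Proof.
move=> uU t t0 i; rewrite !mxE; under eq_fun do rewrite /grid_value !mxE.
by apply: cvgB; [exact: cvg_cst|exact: uU].
Qed.

Lemma discrete_limit_upper_bound (h : 'cV[R]_n -> 'cV[R]_n)
    (u b : nat -> nat -> 'cV[R]_n) (U : R -> 'cV[R]_n) :
  lipschitz_field L h ->
  (forall k, obstacle_euler h K (tau k) (u k) (b k)) -> discrete_limit u U ->
  forall s t i, 0 <= s -> s <= t -> K * (t - s) < U s i 0 ->
    U t i 0 - U s i 0 <= - (t - s) * h (U s) i 0 + L * K * (t - s) ^+ 2.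
Proof.
move=> hL hub uU s t i s0 st lt1.
have hubN k := reflect_obstacle_euler (hub k).
have := @discrete_limit_lower_bound _ _ _ _ (reflect_lipschitz hL) hubN
  (reflect_discrete_limit uU) _ _ i s0 st.
have -> : reflect_field h (const_mx 1 - U s) = - h (U s).
  by rewrite /reflect_field opprB addrCA subrr addr0.
by rewrite !mxE => /(_ ltac:(lra)); lra.
Qed.

Lemma discrete_limit_is_derive (h : 'cV[R]_n -> 'cV[R]_n)
    (u b : nat -> nat -> 'cV[R]_n) (U : R -> 'cV[R]_n) :
  lipschitz_field L h ->
  (forall k, obstacle_euler h K (tau k) (u k) (b k)) -> discrete_limit u U ->
  forall t i, 0 < t -> 0 < U t i 0 < 1 ->
    is_derive t 1 (fun x => U x i 0) (- h (U t) i 0).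
Proof.
move=> hL hub uU t i t0 /andP[U0 U1].
pose m := Num.min (U t i 0) (1 - U t i 0).
have m0 : 0 < m by rewrite lt_min U0 subr_gt0.
have K1 : 0 < 2 * K + 1 by rewrite ltr_wpDl // mulr_ge0.
pose e := Num.min t (m / (2 * K + 1)).
have e0 : 0 < e by rewrite lt_min t0 divr_gt0.
apply: (@is_derive_quadratic_remainder _ _ _ _ (2 * (L * K)) e) => // y.
rewrite lt_min ltr_pdivlMr // => /andP[yt ym].
have [my1 my2] : m <= U t i 0 /\ m <= 1 - U t i 0.
  by split; rewrite ge_min lexx ?orbT.
have y0 : 0 <= y by move: yt; rewrite ltr_norml; lra.
have Kyt : 2 * (K * `|y - t|) < m.
  by apply: le_lt_trans ym; have := normr_ge0 (y - t); lra.
have Ky0 : 0 <= K * `|y - t| by rewrite mulr_ge0.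
have Uy := @discrete_limit_lipschitz _ _ _ _ hub uU _ _ i (ltW t0) y0.
have [ty|yt'] := leP t y.
  have ny : `|y - t| = y - t by rewrite ger0_norm // subr_ge0.
  rewrite ny in Kyt Ky0.
  have h1 := @discrete_limit_lower_bound _ _ _ _ hL hub uU _ _ i (ltW t0) ty ltac:(lra).
  have h2 := @discrete_limit_upper_bound _ _ _ _ hL hub uU _ _ i (ltW t0) ty ltac:(lra).
  have : 0 <= L * K * (y - t) ^+ 2 by rewrite mulr_ge0 ?sqr_ge0 // mulr_ge0.
  by rewrite ler_norml; lra.
have ny : `|y - t| = t - y by rewrite distrC gtr0_norm // subr_gt0.
rewrite ny in Kyt Ky0 Uy; move: Uy; rewrite ler_norml => Uy.
have h1 := @discrete_limit_lower_bound _ _ _ _ hL hub uU _ _ i y0 (ltW yt') ltac:(lra).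
have h2 := @discrete_limit_upper_bound _ _ _ _ hL hub uU _ _ i y0 (ltW yt') ltac:(lra).
have hh : `|h (U y) i 0 - h (U t) i 0| <= L * (K * (t - y)).
  apply: hL => j; rewrite -ny.
  exact: (@discrete_limit_lipschitz _ _ _ _ hub uU _ _ j (ltW t0) y0).
have ty0 : 0 <= t - y by rewrite subr_ge0 ltW.
have {hh} : (t - y) * `|h (U y) i 0 - h (U t) i 0| <= (t - y) * (L * (K * (t - y))).
  by rewrite ler_wpM2l.
rewrite -[X in X * `|_|](ger0_norm ty0) -normrM !ler_norml.
by lra.
Qed.

Lemma multiplier_cvg_below (h : 'cV[R]_n -> 'cV[R]_n)
    (u b : nat -> nat -> 'cV[R]_n) (U : R -> 'cV[R]_n) (t d beta : R) (i : 'I_n) :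
  lipschitz_field L h ->
  (forall k, obstacle_euler h K (tau k) (u k) (b k)) -> discrete_limit u U ->
  0 < t -> U t i 0 < 1 -> is_derive t 1 (fun x => U x i 0) d ->
  d = beta - h (U t) i 0 -> 0 <= beta -> (0 < U t i 0 -> beta <= 0) ->
  b k (step_index t (tau k)) i 0 @[k --> F] --> beta.
Proof.
move=> hL hub uU t0 U1 dU dE beta0 betaU.
have U01 x := discrete_limit_unit_valued hub uU x.
have t0' := ltW t0.
have ut := uU t t0' i.
have lt1 : \forall k \near F, grid_value u t k i 0 < 1 by exact: cvgr_lt ut _ U1.
pose m k := (step_index t (tau k)).-1.
have mE k : step_index t (tau k) = (m k).+1.
  rewrite prednK // lt0n; apply/eqP => s0.
  by have := step_index_bounds t0' (tau0 k); rewrite s0 mul0r leNgt t0.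
have [U0|U0] := ltP 0 (U t i 0).
  have -> : beta = 0 by apply: le_anti; rewrite beta0 betaU.
  have gt0 : \forall k \near F, 0 < grid_value u t k i 0 by exact: cvgr_gt ut _ U0.
  apply: (@cvg_near_cst _ _ _ _ F) => //; near=> k.
  have [b0 b1 _ _] := (hub k).2 (m k) i.
  apply: le_anti; rewrite mE b0 ?b1 // -mE.
    by near: k.
  by near: k.
have {U0} U0 : U t i 0 = 0 by apply: le_anti; rewrite U0 /=; have /andP[] := U01 t t0' i.
have d0 : d = 0.
  apply: le_anti; apply/andP; split.
    apply: (@is_derive_le _ _ _ _ 0 0 t dU t0) => s st; rewrite subrr => s0.
    by rewrite !mulr0 mul0r addr0 U0 sub0r oppr_le0; have /andP[] := U01 s (ltW s0) i.
  apply: (@is_derive_ge _ _ _ _ 0 0 t dU t0) => s ts _.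
  rewrite mulr0 mul0r subr0 U0 subr0.
  by have /andP[] := U01 s (le_trans t0' (ltW ts)) i.
have gE : h (U t) i 0 = beta by apply/esym/eqP; rewrite -subr_eq0 -dE d0.
have um j : u k (m k) j 0 @[k --> F] --> U t j 0.
  apply: (@squeeze_cvgr _ _ _ _ (fun k => grid_value u t k j 0 - K * tau k)
    (fun k => grid_value u t k j 0 + K * tau k)).
  - apply: nearW => k; have [_ _ _] := (hub k).2 (m k) j.
    by rewrite /grid_value mE ler_norml; lra.
  - rewrite -[X in _ --> X]subr0; apply: cvgB; first exact: uU.
    by rewrite -[X in _ --> X](mulr0 K); exact: cvgMr.
  - rewrite -[X in _ --> X]addr0; apply: cvgD; first exact: uU.
    by rewrite -[X in _ --> X](mulr0 K); exact: cvgMr.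
have hm : h (u k (m k)) i 0 @[k --> F] --> beta.
  by rewrite -gE; exact: lipschitz_field_cvg hL um.
have Ktau : K * tau k @[k --> F] --> (0 : R).
  by rewrite -[X in _ --> X](mulr0 K); exact: cvgMr.
have hmK : h (u k (m k)) i 0 + K * tau k @[k --> F] --> beta.
  by rewrite -[X in _ --> X]addr0; exact: cvgD.
have upper k : u k (m k).+1 i 0 < 1 ->
    0 <= b k (m k).+1 i 0 <= Num.max 0 (h (u k (m k)) i 0 + K * tau k).
  move=> uk1; have [b0 b1 e _] := (hub k).2 (m k) i; rewrite b0 //= le_max.
  have [/b1 ->//|u0] := ltP 0 (u k (m k).+1 i 0); apply/orP; right.
  have /andP[u0' _] := (hub k).1 (m k).+1 i; have /andP[um0 _] := (hub k).1 (m k) i.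
  have := tau0 k; rewrite -(ler_pM2l (tau0 k)).
  by move: e; rewrite ler_norml; nra.
have [beta_pos|beta_le] := ltP 0 beta; last first.
  have beta00 : beta = 0 by apply: le_anti; rewrite beta0 beta_le.
  apply: (@squeeze_cvgr _ _ _ _ (fun=> 0)
    (fun k => `|h (u k (m k)) i 0 + K * tau k|)).
  - near=> k; rewrite mE; have /upper/andP[-> /le_trans] : u k (m k).+1 i 0 < 1.
      by rewrite -mE; near: k.
    by apply; rewrite ge_max normr_ge0 ler_norm.
  - by rewrite beta00; exact: cvg_cst.
  - by rewrite -[X in _ --> X](ger0_norm beta0); exact: cvg_norm.
have L1 : 0 < L + 1 by rewrite ltr_wpDl.
have LK1 : 0 < L * K + 1 by rewrite ltr_wpDl // mulr_ge0.
have e0 : 0 < beta / 16 by rewrite divr_gt0.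
have [r r0 hr] := is_derive_littleo dU e0.
pose q := Num.min (Num.min t r) (beta / (16 * (L * K + 1))) / 2.
have q0 : 0 < q by rewrite divr_gt0 // !lt_min t0 r0 divr_gt0 // mulr_gt0.
have : q * 2 <= Num.min (Num.min t r) (beta / (16 * (L * K + 1))) by rewrite divfK.
rewrite !le_min ler_pdivlMr ?mulr_gt0 // => /andP[/andP[qt qr] qLK].
clearbody q.
pose s := t - q.
have s0 : 0 <= s by rewrite /s; lra.
have Us : U s i 0 <= beta / 16 * q.
  have := hr s; rewrite /s addrAC subrr add0r normrN gtr0_norm //.
  by move=> /(_ ltac:(lra)); rewrite U0 d0 ler_norml; lra.
pose p k := (m k - step_index s (tau k))%N.
have sm : \forall k \near F, (step_index s (tau k) <= m k)%N.
  have : \forall k \near F, tau k < q by exact: cvgr_lt tauF _ q0.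
  apply: filterS => k tq; rewrite -ltnS -mE -(ltr_nat R) -(ltr_pM2r (tau0 k)).
  have /andP[_ h1] := step_index_bounds s0 (tau0 k).
  have /andP[h2 _] := step_index_bounds t0' (tau0 k).
  by move: h1; rewrite /s; lra.
have pc : (p k)%:R * tau k @[k --> F] --> q.
  apply: (@cvg_trans _ ((fun k => (step_index t (tau k))%:R * tau k - tau k
      - (step_index s (tau k))%:R * tau k) @ F)).
    apply: near_eq_cvg; near=> k; rewrite /p natrB; last by near: k.
    by rewrite [in LHS]mE -natr1; ring.
  have -> : q = t - 0 - s by rewrite /s; ring.
  by apply: cvgB; [apply: cvgB => //; exact: grid_cvg|exact: grid_cvg].
have near_u : \forall k \near F, forall j,
    `|U t j 0 - grid_value u t k j 0| <= beta / (8 * (L + 1)).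
  apply: filter_forall => j; have /cvgrPdist_le := uU t t0' j; apply.
  by rewrite divr_gt0 // mulr_gt0.
have Ktau2 : 2 * K * tau k @[k --> F] --> (0 : R).
  by rewrite -[X in _ --> X](mulr0 (2 * K)); exact: cvgMr.
have both_zero : \forall k \near F, u k (m k) i 0 = 0 /\ u k (m k).+1 i 0 = 0.
  near=> k.
  have pk_lo : q / 2 < (p k)%:R * tau k.
    by near: k; apply: (cvgr_gt q pc); rewrite ltr_pdivrMr // ltr_pMr // ltr1n.
  have tauq : tau k < q / 2 by near: k; apply: (cvgr_lt 0 tauF); rewrite divr_gt0.
  have pk_hi : (p k)%:R * tau k < q + q / 2.
    by near: k; apply: (cvgr_lt q pc); rewrite ltrDl divr_gt0.
  have smk : (step_index s (tau k) <= m k)%N by near: k.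
  have small : 2 * K * tau k <= beta / 2.
    by near: k; apply: (cvgr_le _ Ktau2); rewrite divr_gt0.
  have us : u k (step_index s (tau k)) i 0 < beta / 8 * q.
    near: k; apply: (cvgr_lt _ (uU s s0 i)).
    by apply: le_lt_trans Us _; rewrite ltr_pM2r // ltr_pM2l // ltf_pV2 ?posrE // ltr_nat.
  have near_uk : forall j, `|U t j 0 - grid_value u t k j 0| <= beta / (8 * (L + 1)) by near: k.
  have drift j : (j < (p k).+1)%N -> beta / 2 <= h (u k (step_index s (tau k) + j)%N) i 0.
    move=> jp.
    have jt : (step_index s (tau k) + j <= step_index t (tau k))%N.
      by rewrite mE -[X in (_ <= X.+1)%N](subnKC smk) -addnS leq_add2l ltnW.
    have dist l : `|U t l 0 - u k (step_index s (tau k) + j)%N l 0| <=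
        beta / (8 * (L + 1)) + K * (2 * q).
      have := euler_lipschitz K0 (hub k) (step_index s (tau k) + j)
        (step_index t (tau k)) l.
      rewrite -mulrBl -natrB // normrM ger0_norm // gtr0_norm //.
      have : K * ((step_index t (tau k) - (step_index s (tau k) + j))%:R * tau k)
          <= K * (2 * q).
        rewrite ler_wpM2l //; apply: (@le_trans _ _ ((p k).+1%:R * tau k)).
          rewrite ler_pM2r // ler_nat mE subSn; last first.
            by rewrite -(subnKC smk) leq_add2l.
          by rewrite ltnS /p subnDA leq_subr.
        by rewrite -natr1 mulrDl mul1r; clear - L0 K0 FF tau0 tauF pk_hi tauq; lra.
      by have := near_uk l; rewrite /grid_value !ler_norml; clear - L0 K0 FF tau0 tauF; lra.
    have := hL _ _ _ dist i; rewrite gE => hb.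
    have h1 : L * (beta / (8 * (L + 1))) <= beta / 8.
      by rewrite mulrA ler_pdivrMr ?mulr_gt0 //; clear - L0 K0 FF tau0 tauF beta_pos; lra.
    have h2 : L * (K * (2 * q)) <= beta / 16.
      by clear - L0 K0 FF tau0 tauF qLK q0; lra.
    by move: hb; rewrite ler_norml; clear - L0 K0 FF tau0 tauF h1 h2; lra.
  have z : forall j, (p k <= j)%N -> (j <= (p k).+1)%N ->
      u k (step_index s (tau k) + j)%N i 0 = 0.
    move=> j pj jp; apply: le_anti; apply/andP; split; last first.
      by have /andP[] := (hub k).1 (step_index s (tau k) + j)%N i.
    have := euler_decay K0 (tau0 k) (hub k) small
      (fun l lj => drift l (leq_trans lj jp)).
    move=> /le_trans; apply; rewrite ge_max lexx /= subr_le0.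
    have : q / 2 * (beta / 2 / 2) <= j%:R * tau k * (beta / 2 / 2).
      rewrite ler_pM2r ?divr_gt0 // (le_trans (ltW pk_lo)) // ler_pM2r //.
      by rewrite ler_nat.
    by clear - L0 K0 FF tau0 tauF us; lra.
  split.
    by rewrite -(subnKC smk) z.
  by rewrite -(subnKC smk) -addnS z.
apply: (@squeeze_cvgr _ _ _ _ (fun k => h (u k (m k)) i 0 - K * tau k)
  (fun k => h (u k (m k)) i 0 + K * tau k)) => //; last first.
  by rewrite -[X in _ --> X]subr0; exact: cvgB.
apply: filterS both_zero => k [z1 z2].
have [_ _ e _] := (hub k).2 (m k) i; move: e; rewrite z1 z2 mE.
rewrite subrr sub0r normrN normrM gtr0_norm // expr2 mulrCA ler_pM2l //.
by rewrite ler_norml; lra.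
Unshelve. all: by end_near. Qed.

Lemma multiplier_cvg (h : 'cV[R]_n -> 'cV[R]_n)
    (u b : nat -> nat -> 'cV[R]_n) (U : R -> 'cV[R]_n) (t d beta : R) (i : 'I_n) :
  lipschitz_field L h ->
  (forall k, obstacle_euler h K (tau k) (u k) (b k)) -> discrete_limit u U ->
  0 < t -> is_derive t 1 (fun x => U x i 0) d -> d = beta - h (U t) i 0 ->
  (U t i 0 < 1 -> 0 <= beta) -> (0 < U t i 0 -> beta <= 0) ->
  b k (step_index t (tau k)) i 0 @[k --> F] --> beta.
Proof.
move=> hL hub uU t0 dU dE b_lo b_hi.
have [U1|U1] := ltP (U t i 0) 1.
  exact: multiplier_cvg_below dU dE (b_lo U1) b_hi.
have Upos : 0 < U t i 0 by apply: lt_le_trans U1.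
have hubN k := reflect_obstacle_euler (hub k).
have dN : is_derive t 1 (fun x => (const_mx 1 - U x) i 0) (0 - d).
  rewrite (_ : (fun x => _) = (fun=> 1) - (fun x => U x i 0)).
    exact: is_deriveB.
  by apply/funext => x; rewrite !mxE.
have -> : beta = - - beta by rewrite opprK.
rewrite -[X in X @ _](_ : (fun k => - (- b k (step_index t (tau k))) i 0) = _); last first.
  by apply/funext => k; rewrite mxE opprK.
apply: cvgN.
apply: (multiplier_cvg_below (reflect_lipschitz hL) hubN (reflect_discrete_limit uU) t0 _ dN).
- by rewrite !mxE; lra.
- rewrite dE; have -> : reflect_field h (const_mx 1 - U t) = - h (U t).
    by rewrite /reflect_field opprB addrCA subrr addr0.
  by rewrite mxE; lra.
- by rewrite oppr_ge0 b_hi.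
- by rewrite !mxE; lra.
Qed.

End DiscreteLimit.

(** * Square-integrable functions *)

Section SquareIntegrable.
Variables (R : realType) (n : nat) (w : 'M[R]_n) (r : R).
Local Notation mu := (@lebesgue_measure R).
Hypothesis d0 : forall i, 0 < degree w i.

Lemma gnorm_sqr (x : 'cV[R]_n) :
  Defs.gnorm w r x ^+ 2 = \sum_i x i 0 ^+ 2 * degree w i `^ r.
Proof.
rewrite sqr_sqrtr /inner; first by apply: eq_bigr => i _; rewrite expr2.
by apply: sumr_ge0 => i _; rewrite -expr2 mulr_ge0 ?sqr_ge0 // powR_ge0.
Qed.

Lemma measurable_gnorm_sqr (a b : R) (v : R -> 'cV[R]_n) :
  (forall i, measurable_fun `]a, b[ (fun t => v t i 0)) ->
  measurable_fun `]a, b[ (fun t => Defs.gnorm w r (v t) ^+ 2).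
Proof.
move=> mv; have -> : (fun t => Defs.gnorm w r (v t) ^+ 2) =
    (fun t => \sum_i v t i 0 ^+ 2 * degree w i `^ r).
  by apply/funext => t; rewrite gnorm_sqr.
apply: measurable_sum => i; apply: measurable_funM => //.
by apply: measurable_funX; exact: mv.
Qed.

Lemma square_integrable_sqr (a b : R) (v : R -> 'cV[R]_n) (i : 'I_n) :
  square_integrable w r a b v ->
  mu.-integrable `]a, b[ (EFin \o (fun t => v t i 0 ^+ 2)).
Proof.
move=> [mv vfin]; have mg := measurable_gnorm_sqr mv.
have gi : mu.-integrable `]a, b[ (EFin \o (fun t => Defs.gnorm w r (v t) ^+ 2)).
  apply/integrableP; split; first exact/measurable_EFinP.
  apply: le_lt_trans vfin; rewrite le_eqVlt; apply/orP; left; apply/eqP.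
  by apply: eq_integral => t _ /=; rewrite ger0_norm ?sqr_ge0.
have p0 : 0 < degree w i `^ r by rewrite powR_gt0.
have cgi : mu.-integrable `]a, b[
    (EFin \o (fun t => (degree w i `^ r)^-1 * Defs.gnorm w r (v t) ^+ 2)).
  exact: integrable_EFinZl.
apply: le_integrable cgi => //.
  by apply/measurable_EFinP; apply: measurable_funX; exact: mv.
move=> t _ /=; rewrite lee_fin ger0_norm ?sqr_ge0 // ger0_norm; last first.
  by rewrite mulr_ge0 ?sqr_ge0 // invr_ge0 ltW.
rewrite ler_pdivlMl // mulrC gnorm_sqr (bigD1 i) //= lerDl.
by apply: sumr_ge0 => j _; rewrite mulr_ge0 ?sqr_ge0 // powR_ge0.
Qed.

Lemma bounded_square_integrable (a b c : R) (v : R -> 'cV[R]_n) :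
  (forall i, measurable_fun setT (fun t => v t i 0)) ->
  (forall t i, `|v t i 0| <= c) -> square_integrable w r a b v.
Proof.
move=> mv vc; have mv' i : measurable_fun `]a, b[ (fun t => v t i 0).
  exact: measurable_funTS.
split=> //.
pose C := \sum_i c ^+ 2 * degree w i `^ r.
have ci : mu.-integrable `]a, b[ (EFin \o (fun=> C)).
  apply: continuous_within_integrable; apply: continuous_subspaceT => x.
  exact: cvg_cst.
have : mu.-integrable `]a, b[ (EFin \o (fun t => Defs.gnorm w r (v t) ^+ 2)).
  apply: le_integrable ci => //.
    by apply/measurable_EFinP; exact: measurable_gnorm_sqr.
  move=> t _ /=; rewrite lee_fin ger0_norm ?sqr_ge0 //.
  apply: le_trans (ler_norm _); rewrite gnorm_sqr; apply: ler_sum => i _.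
  rewrite ler_wpM2r ?powR_ge0 // -real_normK ?num_real //.
  by apply: lerXn2r; rewrite ?nnegrE // (le_trans _ (vc t i)).
move=> /integrableP[_]; apply: le_lt_trans; rewrite le_eqVlt.
apply/orP; left; apply/eqP; apply: eq_integral => t _ /=.
by rewrite ger0_norm ?sqr_ge0.
Qed.

Definition speed_weight (v : R -> 'cV[R]_n) (t : R) : R :=
  Num.sqrt (1 + \sum_i v t i 0 ^+ 2).

Lemma speed_weight_sqr (v : R -> 'cV[R]_n) (t : R) :
  speed_weight v t ^+ 2 = 1 + \sum_i v t i 0 ^+ 2.
Proof.
rewrite sqr_sqrtr // addr_ge0 // sumr_ge0 // => i _; exact: sqr_ge0.
Qed.

Lemma speed_weight_ge1 (v : R -> 'cV[R]_n) (t : R) : 1 <= speed_weight v t.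
Proof.
rewrite -[X in X <= _]sqrtr1 ler_wsqrtr // lerDl.
by apply: sumr_ge0 => i _; exact: sqr_ge0.
Qed.

Lemma le_speed_weight (v : R -> 'cV[R]_n) (i : 'I_n) (t : R) :
  `|v t i 0| <= speed_weight v t.
Proof.
rewrite -sqrtr_sqr ler_wsqrtr // (bigD1 i) //= addrCA lerDl.
by rewrite addr_ge0 // sumr_ge0 // => j _; exact: sqr_ge0.
Qed.

Lemma speed_weight_sqr_integrable (a b : R) (v : R -> 'cV[R]_n) :
  square_integrable w r a b v ->
  mu.-integrable `]a, b[ (EFin \o (fun t => speed_weight v t ^+ 2)).
Proof.
move=> sv; have -> : (fun t => speed_weight v t ^+ 2) =
    (fun t => 1 + \sum_i v t i 0 ^+ 2).
  by apply/funext => t; rewrite speed_weight_sqr.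
apply: integrable_EFinD => //.
  apply: continuous_within_integrable; apply: continuous_subspaceT => x.
  exact: cvg_cst.
have := @integrable_sum _ _ R mu `]a, b[%classic (measurable_itv _) 'I_n
  (index_enum 'I_n) xpredT (fun i t => (v t i 0 ^+ 2)%:E)
  (fun i _ => square_integrable_sqr i sv).
by apply: eq_integrable => // t _; rewrite /= sumEFin.
Qed.

Lemma speed_weight_integrable (a b : R) (v : R -> 'cV[R]_n) :
  square_integrable w r a b v ->
  mu.-integrable `]a, b[ (EFin \o speed_weight v).
Proof.
move=> sv; apply: le_integrable (speed_weight_sqr_integrable sv) => //.
  apply/measurable_EFinP.
  have -> : speed_weight v = Num.sqrt \o (fun t => 1 + \sum_i v t i 0 ^+ 2) by [].
  apply: (@measurable_comp _ _ _ _ _ _ setT) => //.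
    by apply: continuous_measurable_fun; exact: sqrt_continuous.
  apply: measurable_funD => //; apply: measurable_sum => i.
  by apply: measurable_funX; exact: (sv.1 i).
move=> t _ /=; rewrite lee_fin [X in _ <= X]ger0_norm ?sqr_ge0 //.
have := speed_weight_ge1 v t => h1.
by rewrite ger0_norm ?(le_trans ler01) // expr2 ler_peMl // (le_trans ler01).
Qed.

Lemma square_integrable_entry (a b : R) (v : R -> 'cV[R]_n) (i : 'I_n) :
  square_integrable w r a b v ->
  mu.-integrable `]a, b[ (EFin \o (fun t => v t i 0)).
Proof.
move=> sv; apply: le_integrable (speed_weight_integrable sv) => //.
  by apply/measurable_EFinP; exact: (sv.1 i).
move=> t _ /=; rewrite lee_fin; apply: le_trans (ler_norm _).
exact: le_speed_weight.
Qed.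

End SquareIntegrable.

(** * Existence *)

Section H1Increments.
Variables (R : realType) (n : nat) (w : 'M[R]_n) (r : R).
Local Notation mu := (@lebesgue_measure R).
Hypothesis d0 : forall i, 0 < degree w i.
Variables (U v : R -> 'cV[R]_n).
Hypothesis cU : {within [set` `[0, +oo[], continuous U}.
Hypothesis Uv : forall x y : R, 0 <= x -> 0 <= y -> H1_derivative w r x y U v.

Lemma H1_square_integrable (b : R) : 0 <= b -> square_integrable w r 0 b v.
Proof. by move=> b0; have [] := Uv (lexx 0) b0. Qed.

Lemma H1_itv_integrable (s t : R) (g : R -> R) : 0 <= s ->
  (forall b, 0 <= b -> mu.-integrable `]0, b[ (EFin \o g)) ->
  mu.-integrable `]s, t] (EFin \o g).
Proof.
move=> s0 gi; have b0 : 0 <= `|t| + 1 by rewrite addr_ge0.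
apply: integrableS (gi _ b0) => // x /=; rewrite !in_itv /= => /andP[sx xt].
rewrite (le_lt_trans s0 sx) /=; apply: (le_lt_trans xt).
by rewrite (le_lt_trans (ler_norm _)) // ltrDl.
Qed.

Lemma H1_increment (i : 'I_n) (s t : R) : 0 <= s -> s < t ->
  U t i 0 - U s i 0 = \int[mu]_(x in `]s, t]) v x i 0.
Proof.
move=> s0 st; have t0 : 0 <= t by rewrite (le_trans s0) // ltW.
have b0 : 0 <= t + 1 by rewrite addr_ge0.
have [_ sv wv] := Uv (lexx 0) b0.
apply: (@weak_derivative_increment _ 0 (t + 1) s t
  (fun x => U x i 0) (fun x => v x i 0)) => //.
- by rewrite ltrDl.
- have cUi : {within [set` `[0, +oo[], continuous (fun x => U x i 0)}.
    move=> x; apply: (@continuous_comp _ _ _ (U : subspace _ -> _) (fun M => M i 0)).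
      exact: cU.
    exact: coord_continuous.
  apply: continuous_subspaceW cUi => x /=; rewrite !in_itv /= => /andP[-> _].
  by [].
- exact: square_integrable_entry sv.
- by move=> phi tphi; exact: wv.
Qed.

Lemma H1_ae_derivable :
  {ae mu, forall t : R, 0 < t -> forall i,
    is_derive t 1 (fun x => U x i 0) (v t i 0)}.
Proof.
suff h i : {ae mu, forall t : R, 0 < t -> is_derive t 1 (fun x => U x i 0) (v t i 0)}.
  have : {ae mu, forall t : R, forall i, 0 < t -> is_derive t 1 (fun x => U x i 0) (v t i 0)}.
    apply: (@filter_forall _ _ _ _ (ae_filter_ringOfSetsType mu)) => i.
    exact: h.
  by apply: lebesgue_aeS => t ht t0 i; exact: ht.
apply: (@increment_ae_derivable _ (fun x => U x i 0) (fun x => v x i 0)).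
  move=> k; apply: square_integrable_entry => //.
  exact: H1_square_integrable.
by move=> s t; exact: H1_increment.
Qed.

End H1Increments.

Section Existence.
Variables (R : realType) (n : nat) (w : 'M[R]_n) (r : R).
Local Notation mu := (@lebesgue_measure R).
Hypothesis d0 : forall i, 0 < degree w i.
Variables (L K : R) (h : 'cV[R]_n -> 'cV[R]_n).
Hypotheses (L0 : 0 <= L) (K0 : 0 <= K) (hL : lipschitz_field L h).
Variables (F : set_system nat) (tau : nat -> R) (u b : nat -> nat -> 'cV[R]_n).
Hypothesis FF : ProperFilter F.
Hypothesis tau0 : forall k, 0 < tau k.
Hypothesis tauF : tau k @[k --> F] --> (0 : R).
Hypothesis hub : forall k, obstacle_euler h K (tau k) (u k) (b k).
Variable U : R -> 'cV[R]_n.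
Hypothesis uU : discrete_limit F tau u U.
Hypothesis Umax : forall t, U t = U (Num.max t 0).

Let U01 (t : R) : unit_valued (U t).
Proof.
rewrite Umax; apply: (discrete_limit_unit_valued FF hub uU).
by rewrite le_max lexx orbT.
Qed.

Let U_lipschitz (s t : R) (i : 'I_n) : `|U t i 0 - U s i 0| <= K * `|t - s|.
Proof.
rewrite (Umax t) (Umax s).
have m0 x : 0 <= Num.max x 0 :> R by rewrite le_max lexx orbT.
apply: (le_trans (@discrete_limit_lipschitz _ _ _ K0 _ _ FF tau0 tauF _ _ _ _
  hub uU _ _ i (m0 s) (m0 t))).
rewrite ler_wpM2l //.
by rewrite !maxEle; case: (leP t 0) => ?; case: (leP s 0) => ?;
  rewrite ?subrr ?normr0 // ler_norml; have := ler_norm (t - s);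
  have := ler_norm (s - t); rewrite (distrC s); lra.
Qed.

Lemma lipschitz_continuous (f : R -> R) (c : R) : 0 <= c ->
  (forall s t, `|f t - f s| <= c * `|t - s|) -> continuous f.
Proof.
move=> c0 fc x; apply/cvgrPdist_le => e e0.
have c1 : 0 < c + 1 by rewrite ltr_wpDl.
near=> y; apply: (le_trans (fc y x)).
have : `|x - y| <= e / (c + 1).
  by near: y; apply: cvgr_dist_le; [exact: cvg_id|rewrite divr_gt0].
rewrite ler_pdivlMr // => h1; have := normr_ge0 (x - y).
by move: h1; lra.
Unshelve. all: by end_near. Qed.

Let U_continuous (i : 'I_n) : continuous (fun t => U t i 0).
Proof. by apply: (@lipschitz_continuous _ K) => // s t; exact: U_lipschitz. Qed.

Let speed (i : 'I_n) (t : R) : R := - h (U t) i 0.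

Let speed_continuous (i : 'I_n) : continuous (speed i).
Proof.
apply: (@lipschitz_continuous _ (L * K)); first exact: mulr_ge0.
move=> s t; rewrite /speed -opprD normrN -mulrA.
by apply: hL => j; exact: U_lipschitz.
Qed.

Definition limit_speed (t : R) : 'cV[R]_n :=
  \col_i free_speed (fun x => U x i 0) (fun x => - h (U x) i 0) t.

Lemma limit_H1_derivative (x y : R) : 0 <= x -> 0 <= y ->
  H1_derivative w r x y U limit_speed.
Proof.
move=> x0 y0.
have [H H0 hH] := lipschitz_field_bounded L0 hL.
split.
- apply: (@bounded_square_integrable _ _ _ _ _ _ 1).
    by move=> i; exact: continuous_measurable_fun.
  by move=> t i; have /andP[U0 U1] := U01 t i; rewrite ger0_norm.
- apply: (@bounded_square_integrable _ _ _ _ _ _ H).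
    move=> i; have -> : (fun t => limit_speed t i 0) =
        free_speed (fun x => U x i 0) (speed i) by apply/funext => t; rewrite mxE.
    apply: measurable_free_speed; [exact: U_continuous|exact: speed_continuous|].
    by move=> t; exact: U01.
  move=> t i; rewrite mxE /free_speed; case: ifP => _; last by rewrite normr0.
  by rewrite normrN hH.
- move=> phi tphi i.
  rewrite (@free_speed_weak_derivative _ _ _ (@U_continuous i) (@speed_continuous i)
    (fun t => U01 t i) _ _ phi _ tphi).
    by congr (- _); apply: eq_Rintegral => t _; rewrite mxE.
  move=> t; rewrite in_itv /= => /andP[xt _] Ut.
  exact: (@discrete_limit_is_derive _ _ _ _ L0 K0 _ _ FF tau0 tauF _ _ _ _ hL hub uU
    t i (le_lt_trans x0 xt) Ut).
Qed.

Lemma limit_continuous : continuous U.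
Proof.
move=> t; apply: cvg_mx_entries => i j; rewrite (ord1 j).
exact: U_continuous.
Qed.

Lemma limit_ae_derivable :
  {ae mu, forall t : R, 0 < t -> forall i,
    is_derive t 1 (fun x => U x i 0) (limit_speed t i 0)}.
Proof.
apply: (H1_ae_derivable (w := w) (r := r)) => //.
  exact/continuous_subspaceT/limit_continuous.
exact: limit_H1_derivative.
Qed.

End Existence.

Lemma ultra_discrete_limit (R : realType) (n : nat) (F : set_system nat)
    (tau : nat -> R) (u : nat -> nat -> 'cV[R]_n) : UltraFilter F ->
  (forall k m, unit_valued (u k m)) ->
  exists2 U, discrete_limit F tau u U & forall t, U t = U (Num.max t 0).
Proof.
move=> FU u01.
have lim t i : exists l : R, grid_value tau u (Num.max t 0) k i 0 @[k --> F] --> l.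
  by apply: (@ultra_cvg_itv _ _ _ 0 1) => k; exact: u01.
pose U t : 'cV[R]_n := \col_i projT1 (cid (lim t i)).
have UE t i : grid_value tau u (Num.max t 0) k i 0 @[k --> F] --> U t i 0.
  by rewrite mxE; case: cid.
exists U.
  by move=> t t0 i; have := UE t i; rewrite (max_idPl t0).
move=> t; apply/matrixP => i j; rewrite (ord1 j).
have FP : ProperFilter F by exact: ultra_proper.
apply: (cvg_unique _ (UE t i)) => //.
by have := UE (Num.max t 0) i; rewrite -maxA maxxx.
Qed.

Section ObstacleSign.
Variables (R : realType) (n : nat) (L K : R).
Hypotheses (L0 : 0 <= L) (K0 : 0 <= K).
Variables (F : set_system nat) (tau : nat -> R).
Hypothesis FF : ProperFilter F.
Hypothesis tau0 : forall k, 0 < tau k.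
Hypothesis tauF : tau k @[k --> F] --> (0 : R).

Lemma limit_field_ge0 (h : 'cV[R]_n -> 'cV[R]_n)
    (u b : nat -> nat -> 'cV[R]_n) (U : R -> 'cV[R]_n) (t d : R) (i : 'I_n) :
  lipschitz_field L h ->
  (forall k, obstacle_euler h K (tau k) (u k) (b k)) ->
  discrete_limit F tau u U -> 0 < t -> U t i 0 = 0 ->
  is_derive t 1 (fun x => U x i 0) d -> 0 <= h (U t) i 0.
Proof.
move=> hL hub uU t0 Ut dU; have t0' := ltW t0.
have K1 : 0 < K + 1 by rewrite ltr_wpDl.
have d_le : d <= 0.
  apply: (@is_derive_le _ _ _ _ 0 0 t dU t0) => s st; rewrite subrr => s0.
  rewrite !mulr0 mul0r addr0 Ut sub0r oppr_le0.
  by have /andP[] := discrete_limit_unit_valued FF hub uU (ltW s0) i.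
have r0 : 0 < (K + 1)^-1 by rewrite invr_gt0.
have : - h (U t) i 0 <= d.
  apply: (@is_derive_ge _ _ _ _ _ (L * K) _ dU r0) => s ts sr.
  rewrite mulrN -mulNr.
  apply: (@discrete_limit_lower_bound _ _ _ _ L0 K0 _ _ FF tau0 tauF _ _ _ _
    hL hub uU _ _ i t0' (ltW ts)).
  have : (s - t) * (K + 1) < 1 by rewrite -ltr_pdivlMr // mul1r; lra.
  have : 0 <= K * (s - t) by rewrite mulr_ge0 // subr_ge0 ltW.
  by rewrite Ut; lra.
by move=> /le_trans/(_ d_le); rewrite oppr_le0.
Qed.

End ObstacleSign.

Section LimitSolution.
Variables (R : realType) (n : nat) (w : 'M[R]_n) (r : R).
Local Notation mu := (@lebesgue_measure R).
Hypothesis d0 : forall i, 0 < degree w i.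
Variables (A : 'M[R]_n) (f : 'cV[R]_n) (eps L K : R).
Local Notation h := (ACE_field A f eps).
Hypotheses (eps0 : 0 < eps) (L0 : 0 <= L) (K0 : 0 <= K).
Hypothesis hL : lipschitz_field L h.
Variables (tau : nat -> R) (u b : nat -> nat -> 'cV[R]_n).
Hypothesis tau0 : forall k, 0 < tau k.
Hypothesis tau_cvg : tau k @[k --> \oo] --> (0 : R).
Hypothesis hub : forall k, obstacle_euler h K (tau k) (u k) (b k).
Variable u0 : 'cV[R]_n.
Hypothesis u_init : forall k, u k 0%N = u0.

Lemma ACE_equationE (v x y : 'cV[R]_n) :
  eps *: v + eps *: (A *m x) - eps *: f + 2^-1 *: const_mx 1 - x = y <->
  forall i, v i 0 = (eps^-1 *: y) i 0 - h x i 0.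
Proof.
have ne0 : eps != 0 by rewrite gt_eqF.
rewrite /ACE_field; move: (A *m x) => Ax; split=> [<- i|vE].
  by rewrite !mxE; field.
apply/matrixP => i j; rewrite (ord1 j); have := vE i; rewrite !mxE => ->.
by field.
Qed.

Lemma lebesgue_ae_neq0 : {ae mu, forall t : R, t != 0}.
Proof.
exists [set 0]; split => //; first exact: lebesgue_measure_set1.
by move=> x /= /negP; rewrite negbK => /eqP.
Qed.

Lemma ACE_solution_exists : exists U gamma : R -> 'cV[R]_n,
  ACE_solution w r A f eps `[0, +oo[ U gamma /\ U 0 = u0.
Proof.
have [F [FU Foo]] := @ultraFilterLemma nat \oo _.
have FF : ProperFilter F by exact: ultra_proper.
have tauF : tau k @[k --> F] --> (0 : R) by move=> B /tau_cvg; exact: Foo.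
have [|U uU Umax] := @ultra_discrete_limit R n F tau u FU.
  by move=> k m; exact: (hub k).1.
pose v := limit_speed h U.
pose gamma t : 'cV[R]_n := eps *: (v t + h (U t)).
have H1 := limit_H1_derivative w r L0 K0 hL FF tau0 tauF hub uU Umax.
have H_der := limit_ae_derivable r d0 L0 K0 hL FF tau0 tauF hub uU Umax.
have U01 t : 0 <= t -> unit_valued (U t).
  by move=> t0; exact: (discrete_limit_unit_valued FF hub uU t0).
exists U, gamma; split; last first.
  apply/matrixP => i j; rewrite (ord1 j).
  apply: (cvg_unique _ (uU 0 (lexx 0) i)) => //.
  have -> : (fun k => grid_value tau u 0 k i 0) = (fun=> u0 i 0).
    by apply/funext => k; rewrite /grid_value /step_index mul0r ceil0 u_init.
  exact: cvg_cst.
split.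
- by move=> t; rewrite in_itv /= andbT; exact: U01.
- move=> x y; rewrite !in_itv /= !andbT => x0 y0.
  by exists v; exact: H1.
- exact/continuous_subspaceT/(limit_continuous K0 FF tau0 tauF hub uU Umax).
exists v; first by move=> x y; rewrite !in_itv /= !andbT; exact: H1.
apply: lebesgue_aeS (lebesgue_aeI lebesgue_ae_neq0 H_der) => t [tn0 dU].
rewrite in_itv /= andbT => t0; have tpos : 0 < t by rewrite lt_neqAle eq_sym tn0.
have {dU} dU := dU tpos.
split.
  apply/ACE_equationE => i; rewrite /gamma scalerA mulVf ?gt_eqF // scale1r.
  by rewrite [X in _ = X - _]mxE addrK.
split=> [|i]; first exact: U01.
have vE : v t i 0 = free_speed (fun x => U x i 0) (fun x => - h (U x) i 0) t.
  by rewrite mxE.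
have gE : gamma t i 0 = eps * (v t i 0 + h (U t) i 0) by rewrite !mxE.
split=> Ut.
- rewrite gE pmulr_rge0 // vE /free_speed Ut ltxx /= add0r.
  exact: (@limit_field_ge0 _ _ _ _ L0 K0 _ _ FF tau0 tauF _ _ _ _ _ _ i
    hL hub uU tpos Ut (dU i)).
- by rewrite gE vE /free_speed Ut addNr mulr0.
- rewrite gE pmulr_rle0 // vE /free_speed Ut ltxx andbF add0r -oppr_ge0.
  have hubN k := reflect_obstacle_euler (hub k).
  have dN : is_derive t 1 (fun x => (const_mx 1 - U x) i 0) (0 - v t i 0).
    rewrite (_ : (fun x => _) = (fun=> 1) - (fun x => U x i 0)).
      exact: is_deriveB.
    by apply/funext => x; rewrite !mxE.
  have UtN : (const_mx 1 - U t) i 0 = 0 by rewrite !mxE Ut subrr.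
  have := @limit_field_ge0 _ _ _ _ L0 K0 _ _ FF tau0 tauF _ _ _ _ _ _ i
    (reflect_lipschitz hL) hubN (reflect_discrete_limit FF uU) tpos UtN dN.
  have -> : reflect_field h (const_mx 1 - U t) = - h (U t).
    by rewrite /reflect_field opprB addrCA subrr addr0.
  by rewrite mxE.
Qed.

Variables (U gamma : R -> 'cV[R]_n).
Hypothesis sol : ACE_solution w r A f eps `[0, +oo[ U gamma.
Hypothesis U0 : U 0 = u0.
Hypothesis tau1 : forall k, tau k <= 1.

Let cU : {within [set` `[0, +oo[], continuous U}.
Proof. by case: sol. Qed.

Let U01 (t : R) : 0 <= t -> unit_valued (U t).
Proof. by case: sol => h01 _ _ _ t0; apply: h01; rewrite in_itv /= andbT. Qed.

Lemma ACE_solution_speed : exists2 v : R -> 'cV[R]_n,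
  forall x y, 0 <= x -> 0 <= y -> H1_derivative w r x y U v
  & {ae mu, forall t : R, 0 <= t -> forall i,
      [/\ v t i 0 = (eps^-1 *: gamma t) i 0 - h (U t) i 0,
          U t i 0 < 1 -> 0 <= (eps^-1 *: gamma t) i 0
        & 0 < U t i 0 -> (eps^-1 *: gamma t) i 0 <= 0]}.
Proof.
have [_ _ _ [v Hv eqn]] := sol; exists v.
  by move=> x y x0 y0; apply: Hv; rewrite in_itv /= andbT.
apply: lebesgue_aeS eqn => t ht t0 i.
have [|/ACE_equationE -> [Ut /(_ i)[b_lo b_mid b_hi]]] := ht.
  by rewrite in_itv /= andbT.
have ieps : 0 < eps^-1 by rewrite invr_gt0.
have /andP[Ut0 Ut1] := Ut i; rewrite mxE; split=> // Uti.
- rewrite pmulr_rge0 //; move: Ut0; rewrite le_eqVlt => /predU1P[/esym/b_lo//|Upos].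
  by rewrite b_mid // Upos.
- rewrite pmulr_rle0 //; move: Ut1; rewrite le_eqVlt => /predU1P[/b_hi//|Ulow].
  by rewrite b_mid // Uti.
Qed.

Lemma ACE_solution_limit : discrete_limit \oo tau u U.
Proof.
move=> t t0 i; have [v Hv eqn] := ACE_solution_speed.
have [H H0 hH] := lipschitz_field_bounded L0 hL.
have sv c : 0 <= c -> square_integrable w r 0 c v.
  by move=> c0; exact: H1_square_integrable Hv _ c0.
have [C err] : exists C, forall k,
    (u k (step_index t (tau k)) i 0 - U t i 0) ^+ 2 <= C * tau k.
  eexists => k.
  apply: (@euler_error R n h L K H L0 K0 H0 hL hH U v (fun t => eps^-1 *: gamma t)
    (speed_weight v)) (tau0 k) (tau1 k) (hub k) _ _ i t0 => //.
  - by move=> j s s'; exact: H1_increment Hv j s s'.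
  - move=> j s s' s0; apply: H1_itv_integrable s0 _ => c c0.
    exact: square_integrable_entry (sv c c0).
  - move=> s s' s0; apply: H1_itv_integrable s0 _ => c c0.
    exact: speed_weight_integrable (sv c c0).
  - move=> s s' s0; apply: H1_itv_integrable s0 _ => c c0.
    exact: speed_weight_sqr_integrable (sv c c0).
  - exact: speed_weight_ge1.
  - by move=> j x; exact: le_speed_weight.
  - by rewrite U0 u_init.
apply/cvgrPdist_le => e e0.
have C1 : 0 < `|C| + 1 by rewrite ltr_wpDl.
near=> k.
have tk : tau k <= e ^+ 2 / (`|C| + 1).
  by near: k; apply: (cvgr_le _ tau_cvg); rewrite divr_gt0 // exprn_gt0.
rewrite distrC -(@ler_pXn2r _ 2) ?nnegrE ?(ltW e0) // real_normK ?num_real //.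
apply: (le_trans (err k)); move: tk; rewrite ler_pdivlMr //.
have := ler_norm C; have := tau0 k => tk0 CC.
have : C * tau k <= (`|C| + 1) * tau k by rewrite ler_pM2r //; lra.
by lra.
Unshelve. all: by end_near. Qed.

Lemma ACE_multiplier_limit :
  {ae mu, forall t : R, 0 <= t -> forall i,
    b k (step_index t (tau k)) i 0 @[k --> \oo] --> (eps^-1 *: gamma t) i 0}.
Proof.
have [v Hv eqn] := ACE_solution_speed.
have dU := H1_ae_derivable d0 cU Hv.
apply: lebesgue_aeS (lebesgue_aeI lebesgue_ae_neq0 (lebesgue_aeI dU eqn)).
move=> t [tn0 [{}dU {}eqn]] t0 i.
have tpos : 0 < t by rewrite lt_neqAle eq_sym tn0.
have [vE b_lo b_hi] := eqn t0 i.
exact: (multiplier_cvg L0 K0 _ tau0 tau_cvg hL hub ACE_solution_limit tpos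
  (dU tpos i) vE b_lo b_hi).
Qed.

End LimitSolution.

Unset Implicit Arguments.

Theorem theorem2p17 (R : realType) (n : nat) (hn : (1 < n)%N)
    (w : 'M[R]_n) (hw : connected_weighted_graph w)
    (r : R) (hr : 0 <= r <= 1)
    (mu ftilde : 'cV[R]_n)
    (hmu : nonneg_valued mu) (hmu0 : mu != 0) (hft : unit_valued ftilde)
    (u0 : 'cV[R]_n) (hu0 : unit_valued u0)
    (eps : R) (heps : 0 < eps)
    (hspec : ~ spectrum (fidelity_op w r mu) eps^-1)
    (tau : nat -> R) (htau0 : forall k, 0 < tau k)
    (htaud : nonincreasing_seq tau)
    (htau : tau k @[k --> \oo] --> (0 : R))
    (u b : R -> nat -> 'cV[R]_n)
    (hsdie : forall s : R, 0 < s < eps ->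
       SDIE_iterates (fidelity_op w r mu) (fidelity_force mu ftilde)
         eps s u0 (u s) (b s)) :
  exists p : nat -> nat,
    [/\ {homo p : i j / (i < j)%N},
        forall k, tau (p k) < eps,
        exists uhat gamma : R -> 'cV[R]_n,
          ACE_solution w r (fidelity_op w r mu) (fidelity_force mu ftilde)
            eps `[0, +oo[ uhat gamma /\ uhat 0 = u0
      & forall uhat gamma : R -> 'cV[R]_n,
          ACE_solution w r (fidelity_op w r mu) (fidelity_force mu ftilde)
            eps `[0, +oo[ uhat gamma ->
          uhat 0 = u0 ->
          (forall t : R, 0 <= t ->
             u (tau (p k)) (step_index t (tau (p k))) @[k --> \oo] --> uhat t)
          /\
          exists N : nat -> nat,
            [/\ forall k, (0 < N k)%N,
                N k @[k --> \oo] --> \oo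
              & {ae (@lebesgue_measure R), forall t : R, 0 <= t ->
                  (N k)%:R^-1 *:
                    (\sum_(j < N k)
                       b (tau (p j)) (step_index t (tau (p j))))
                  @[k --> \oo] --> gamma t}]].
Proof.
have d0 i : 0 < degree w i by exact: degree_gt0.
have Aunit : fidelity_op w r mu \in unitmx by exact: fidelity_op_unit.
move: (fidelity_op w r mu) (fidelity_force mu ftilde) Aunit hsdie {hspec}
  => A f Aunit hsdie.
have [L L0 hL] := ACE_field_lipschitz A f heps.
have [K K0 hK] := SDIE_obstacle_euler f Aunit heps.
have m0 : 0 < Num.min 1 (eps / 2) by rewrite lt_min ltr01 divr_gt0.
have [k0 _ hk0] : \forall k \near \oo, tau k < Num.min 1 (eps / 2).
  exact: cvgr_lt htau _ m0.
pose p k := (k + k0)%N.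
have small k : tau (p k) < Num.min 1 (eps / 2) by apply: hk0; exact: leq_addl.
have tau1 k : tau (p k) <= 1 by have := small k; rewrite lt_min => /andP[/ltW].
have taue k : tau (p k) <= eps / 2.
  by have := small k; rewrite lt_min => /andP[_ /ltW].
have tau_eps k : tau (p k) < eps.
  by apply: le_lt_trans (taue k) _; rewrite ltr_pdivrMr // ltr_pMr // ltr1n.
have taup_cvg : tau (p k) @[k --> \oo] --> (0 : R).
  by have := htau; rewrite -(cvg_shiftn k0).
have sdie k : SDIE_iterates A f eps (tau (p k)) u0 (u (tau (p k))) (b (tau (p k))).
  by apply: hsdie; rewrite htau0 tau_eps.
have hub k := hK _ (htau0 (p k)) (tau1 k) (taue k) _ _ _ hu0 (sdie k).
have u_init k : u (tau (p k)) 0%N = u0 by have [] := sdie k.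
exists p; split; [by move=> i j; rewrite /p ltn_add2r|exact: tau_eps| |].
  exact: (ACE_solution_exists r d0 heps L0 K0 hL (fun k => htau0 (p k)) taup_cvg
    hub u_init).
move=> uhat gamma sol uhat0; split.
  move=> t t0; apply: cvg_mx_entries => i j; rewrite (ord1 j).
  exact: (ACE_solution_limit d0 heps L0 K0 hL (fun k => htau0 (p k)) taup_cvg hub
    u_init sol uhat0 tau1 t0).
exists succn; split=> //.
  by move=> B [m _ mB]; exists m => // k mk; apply: mB; exact: leqW.
have := ACE_multiplier_limit d0 heps L0 K0 hL (fun k => htau0 (p k)) taup_cvg hub
  u_init sol uhat0 tau1.
apply: lebesgue_aeS => t ht t0; apply: cvg_mx_entries => i j; rewrite (ord1 j).
have bi : b (tau (p k)) (step_index t (tau (p k))) i 0 @[k --> \oo] --> gamma t i 0.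
  have -> : gamma t i 0 = eps * (eps^-1 *: gamma t) i 0.
    by rewrite mxE mulrA mulfV ?mul1r // gt_eqF.
  apply: cvg_trans (cvgMr (ht t0 i)); apply: near_eq_cvg.
  by apply: nearW => k; rewrite /= mxE mulrA mulfV ?mul1r // gt_eqF.
have := cesaro bi; apply: cvg_trans; apply: near_eq_cvg; apply: nearW => k.
by rewrite /arithmetic_mean /= /series /= mxE summxE big_mkord.
Qed.
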